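(* Let $k$ be a field of characteristic zero. For every integer $n\geq 3$, put $s=\frac{n(n+1)}{2}+1$ and let $I_n$ be the ideal of $S=k[x_1,\dots,x_s]$ generated by the monomials $x_1^2,x_2^2,\dots,x_{n+1}^2$, the monomials $x_1x_2,x_1x_3,\dots,x_1x_{n+1}$, and the binomials $$x_ix_j-x_1x_{t(n,i,j)},\qquad 2\leq i<j\leq n+1,$$ where $t(n,i,j)=(i-1)n-\frac{(i-1)(i-2)}{2}+1+(j-i)$. Then $\mathrm{reg}(I_n)=2$ and $\mathrm{reg}(I_n^2)>4$. Therefore $\{I_n\}_{n\geq 3}$ is an infinite family of ideals having a regularity jump at $k=2$ (i.e. at the second power).
   Context: The ring $S$ carries the standard grading ($\deg x_i=1$). For a finitely generated graded $S$-module $M$ with minimal graded free resolution $\cdots\to F_i\to F_{i-1}\to\cdots\to F_0\to M\to 0$, $F_i=\bigoplus_j S(-a_{ij})$, the Castelnuovo-Mumford regularity is $\mathrm{reg}(M)=\sup_{i,j}\{a_{ij}-i\}$. For a homogeneous ideal $I$, $\mathrm{reg}(I)$ denotes the regularity of $I$ regarded as a graded $S$-module (not of $S/I$). A homogeneous ideal $I$ generated in a single degree $d$ is said to have a regularity jump at $k$ (here $k$ is a positive integer, the exponent of the power) if $\mathrm{reg}(I^k)-\mathrm{reg}(I^{k-1})>d$. The map $(i,j)\mapsto t(n,i,j)$ enumerates the pairs $2\leq i<j\leq n+1$ lexicographically by the indices $n+2,\dots,s$. Equivalently, after renaming variables, $I_n=(x^2,y_1^2,\dots,y_n^2,xy_1,\dots,xy_n,\;y_iy_j-xz_{i,j}\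 (1\leq i<j\leq n))$ in the polynomial ring over the same field in the variables $x,y_1,\dots,y_n$ and $z_{i,j}$ ($1\leq i<j\leq n$). *)

(* Defs.v *)
From mathcomp Require Import all_boot all_order all_algebra.
From mathcomp Require Import mpoly.
From mathcomp Require Import classical_sets constructive_ereal.

Set Implicit Arguments.
Unset Strict Implicit.
Unset Printing Implicit Defensive.

Import Order.TTheory GRing.Theory Num.Theory.

Local Open Scope classical_set_scope.
Local Open Scope ring_scope.

Section Ideals.
Variable A : comNzRingType.
Implicit Types G I J : set A.

Definition ideal_gen G : set A :=
  [set f | exists (m : nat) (c g : 'I_m -> A),
     (forall i, G (g i)) /\ f = \sum_(i < m) c i * g i].

Definition ideal_mul I J : set A :=
  ideal_gen [set f | exists a b, [/\ I a, J b & f = a * b]].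

(* I^0 is the unit ideal *)
Definition ideal_exp I (k : nat) : set A := iter k (ideal_mul I) setT.

End Ideals.

Section Regularity.
Variables (K : fieldType) (s : nat).
Local Notation S := {mpoly K[s]}.
Implicit Type I : set S.

Definition homog_deg (d : int) (p : S) : Prop :=
  match d with
  | Posz e => p \is e.-homog
  | Negz _ => p = 0
  end.

(* Data of a sequence of finite free graded modules and S-linear maps
     ... -> F_2 -> F_1 -> F_0 -> S,   F_i = \bigoplus_(j < rk i) S(- shift j),
   where F_i is the space of row vectors 'rV[S]_(rk i), the j-th basis vector
   has degree shift j, and the maps are right multiplications by dif i
   (from F_(i+1) to F_i) and by aug (from F_0 to S). *)
Record free_seq := FreeSeq {
  rk : nat -> nat;
  shift : forall i, 'I_(rk i) -> int;
  dif : forall i, 'M[S]_(rk i.+1, rk i);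
  aug : 'cV[S]_(rk 0)
}.

(* F is a minimal graded free resolution
     ... -> F_1 -> F_0 -> I -> 0
   of the ideal I as a graded S-module: all maps are homogeneous of degree 0,
   the image of aug is I, the sequence is exact, and it is minimal, i.e. the
   image of F_(i+1) lies in (x_1, ..., x_s) F_i: no entry of dif i has a
   constant term. *)
Definition minimal_graded_free_resolution (F : free_seq) I : Prop :=
  [/\ (forall p, homog_deg (shift p) (aug F p 0))
      /\ (forall i p q, homog_deg (shift p - shift q) (dif F i p q)),
      forall f : S, I f <-> exists u : 'rV_(rk F 0), f = (u *m aug F) 0 0,
      (forall u : 'rV_(rk F 0),
         u *m aug F = 0 <-> exists v : 'rV_(rk F 1), u = v *m dif F 0)
      /\ (forall i (u : 'rV_(rk F i.+1)),
            u *m dif F i = 0 <-> exists v : 'rV_(rk F i.+2), u = v *m dif F i.+1)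
    & forall i p q, (dif F i p q)@_0%MM = 0].

(* The supremum ranges over all minimal resolutions of I; as these are
   isomorphic to one another, each of them yields the same values
   shift j - i. *)
Definition reg I : \bar int :=
  supremum -oo%E
    [set r | exists (F : free_seq) (i : nat) (j : 'I_(rk F i)),
       minimal_graded_free_resolution F I /\ r = (shift j - i%:Z)%:E].

Definition generated_in_degree (d : nat) I : Prop :=
  exists G : set S, (forall g, G g -> g \is d.-homog) /\ I = ideal_gen G.

Definition regularity_jump I (k : nat) : Prop :=
  (0 < k)%N /\
  exists d : nat, generated_in_degree d I /\
    (d%:Z%:E < reg (ideal_exp I k) - reg (ideal_exp I k.-1))%E.

End Regularity.

Definition nvars (n : nat) : nat := ((n * n.+1) %/ 2).+1.

Definition tidx (n i j : nat) : nat :=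
  (i.-1 * n - (i.-1 * (i - 2)) %/ 2 + 1 + (j - i))%N.

(* The variable x_i, numbered from 1 as in x_1, ..., x_s; the junk value x_1
   taken outside of the range 1 <= i <= s is never used below. *)
Definition xvar (K : fieldType) (n i : nat) : {mpoly K[nvars n]} :=
  'X_(inord i.-1).
Arguments xvar : clear implicits.

Definition idealI_gens (K : fieldType) (n : nat) : set {mpoly K[nvars n]} :=
  let x := xvar K n in
  [set f | exists2 i : nat, (1 <= i <= n.+1)%N & f = x i ^+ 2]
  `|` [set f | exists2 i : nat, (2 <= i <= n.+1)%N & f = x 1%N * x i]
  `|` [set f | exists i j : nat, [/\ (2 <= i)%N, (i < j)%N, (j <= n.+1)%N
                & f = x i * x j - x 1%N * x (tidx n i j)]].
Arguments idealI_gens : clear implicits.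

Definition idealI (K : fieldType) (n : nat) : set {mpoly K[nvars n]} :=
  ideal_gen (idealI_gens K n).
Arguments idealI : clear implicits.

(* Main.v *)
From HB Require Import structures.
Require Import Defs.
From mathcomp Require Import all_boot all_order all_algebra.
From mathcomp Require Import mpoly.
From mathcomp Require Import boolp classical_sets constructive_ereal.
From mathcomp Require Import ring zify.
From mathcomp Require cardinality.

Set Implicit Arguments.
Unset Strict Implicit.
Unset Printing Implicit Defensive.

Import Order.TTheory GRing.Theory Num.Theory.

Local Open Scope ring_scope.

(** Write Y_0 = x, Y_i = y_i and let g_ij = Y_i Y_j - d_ij Y_0 z_ij for
    0 <= i <= j <= n, where d_ij is 1 if 1 <= i < j and 0 otherwise; these are
    the generators of I = I_n. The theorem has two halves.

    The regularity of I. Order the g_ij lexicographically. The polynomials f such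
    that f g_ij lies in the ideal of the earlier generators form the ideal
    (Y_l : l < j): the generators behave like the products Y_i Y_j, which they
    deform ([linear_quotients_deformed]). An ideal, or a submodule of a free
    module, whose generators have one degree d and whose successive quotients are
    of this form, generated by variables, has linear quotients. Its syzygies are
    generated in degree d + 1, and this generating family has linear quotients
    again ([linear_quotients_syzygies]). A minimal cover of such a module differs
    from the given generators by an invertible matrix of constants
    ([linear_quotients_min_cover]), so by induction every minimal resolution of I
    has only the shift i + 2 in homological degree i.

    The regularity of J = I^2. It suffices that every minimal resolution F of J
    has a generator of degree 7 in F_2, that is, Tor_2(J, K) is nonzero in degree
    7. Put f = x y_1 y_2 y_3. Modulo J this element is killed by z_12, z_13 and
    z_23, so the Koszul boundary of e_12 /\ e_13 /\ e_23 times f is a 2-cycle of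
    the Koszul complex of J. If F_2 had no generator of degree 7, a chase through
    the double complex of F and the Koszul complex would make it a boundary
    with coefficients R in J ([koszul_chase]). The Koszul complex is contracted
    by the derivations divided by degrees, which is where characteristic zero
    enters.
    To see that the cycle is no boundary, map x to t, y_i to t u_i and z_ij to
    t u_i u_j for i, j <= 3, and all other variables to 0. This kills the
    binomials, and J is mapped into the ideal of the products of two elements of
    {t^2, t^2 u_i, t^2 u_i^2}. In the component of the cycle at e_12 /\ e_13, the
    coefficient of t^5 u_1 u_2^2 u_3^2 can only come from the coefficient of
    t^4 u_2^2 u_3^2 in R(z_12, z_13, y_1), which is therefore 1; in the component
    at y_1 and z_12, which vanishes, the coefficient of t^5 u_1 u_2^2 u_3^3 shows
    that the same number is 0.

    As the regularity is a supremum over the minimal resolutions, their existence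
    is part of the proof: submodules of finite free modules are finitely
    generated ([submodule_fgen]), and covers by a least number of homogeneous
    generators are iterated ([exists_min_resolution]). *)

(** * Homogeneous components *)

Section ScaleCoef.
Variables (K : fieldType) (s : nat).
Local Notation S := {mpoly K[s]}.
Implicit Types (p q : S) (m : 'X_{1..s}) (w : 'X_{1..s} -> K).

(** Projections to a homogeneous component, and divisions by the degree, are
    both of this form. *)
Definition scale_coef w p : S := \sum_(m <- msupp p) (w m * p@_m) *: 'X_[m].

Lemma mcoeff_scale_coef w p m : (scale_coef w p)@_m = w m * p@_m.
Proof.
rewrite /scale_coef raddf_sum /=; under eq_bigr do rewrite mcoeffZ mcoeffX.
have [mp|mp] := boolP (m \in msupp p).
  rewrite (bigD1_seq m) //= eqxx mulr1 big1 ?addr0 // => i /negPf ->.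
  by rewrite mulr0.
rewrite (memN_msupp_eq0 mp) mulr0 big_seq big1 // => i ip.
by case: eqP => [E|]; rewrite ?mulr0 //; rewrite -E ip in mp.
Qed.

Lemma mcoeff_mulXm k p m :
  ('X_[k] * p)@_m = if (k <= m)%MM then p@_(m - k) else 0.
Proof.
case: ifP => km.
  by rewrite mulrC -{1}(submK km) [(m - k + k)%MM]addmC mcoeffMX.
apply/eqP; rewrite mcoeff_eq0 mulrC; apply/negP => /msuppM_le /allpairsP.
move=> [[a b] /= [_]]; rewrite msuppX inE => /eqP -> E.
by move: km; rewrite E lem_addl.
Qed.

Lemma mcoeff_mulXU (i : 'I_s) p m :
  ('X_i * p)@_m = if m i == 0%N then 0 else p@_(m - U_(i)).
Proof. by rewrite mcoeff_mulXm lep1mP; case: (m i). Qed.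

Lemma scale_coefZ w c p : scale_coef w (c *: p) = c *: scale_coef w p.
Proof. by apply/mpolyP => m; rewrite !(mcoeffZ, mcoeff_scale_coef) mulrCA. Qed.

Lemma scale_coef_sum w (I : Type) (r : seq I) (P : pred I) (F : I -> S) :
  scale_coef w (\sum_(i <- r | P i) F i) = \sum_(i <- r | P i) scale_coef w (F i).
Proof.
apply/mpolyP => m; rewrite mcoeff_scale_coef !raddf_sum mulr_sumr /=.
by apply: eq_bigr => i _; rewrite mcoeff_scale_coef.
Qed.

Lemma scale_coef_mulXm w k p :
  scale_coef w ('X_[k] * p) = 'X_[k] * scale_coef (fun m => w (k + m)%MM) p.
Proof.
apply/mpolyP => m; rewrite mcoeff_scale_coef !mcoeff_mulXm; case: ifP => km.
  by rewrite mcoeff_scale_coef [(k + _)%MM]addmC submK.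
by rewrite mulr0.
Qed.

Lemma eq_scale_coef w w' p : w =1 w' -> scale_coef w p = scale_coef w' p.
Proof. by move=> E; apply/mpolyP => m; rewrite !mcoeff_scale_coef E. Qed.

Definition hcomp (d : int) p : S := scale_coef (fun m => ((mdeg m)%:Z == d)%:R) p.

Lemma mcoeff_hcomp d p m : (hcomp d p)@_m = ((mdeg m)%:Z == d)%:R * p@_m.
Proof. exact: mcoeff_scale_coef. Qed.

Lemma homog_degP d p :
  homog_deg d p <-> (forall m, (mdeg m)%:Z != d -> p@_m = 0).
Proof.
case: d => e /=; split => H.
- by move=> m; rewrite eqz_nat => me; apply: (dhomog_nemf_coeff H).
- apply/dhomogP => m; rewrite mcoeff_msupp => pm.
  by apply/eqP; apply: contraNT pm => me; rewrite H.
- by move=> m _; rewrite H mcoeff0.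
- by apply/mpolyP => m; rewrite mcoeff0 H.
Qed.

Lemma hcomp_homog d p : homog_deg d (hcomp d p).
Proof. by apply/homog_degP => m /negPf E; rewrite mcoeff_hcomp E mul0r. Qed.

Lemma hcomp_id d p : homog_deg d p -> hcomp d p = p.
Proof.
move=> /homog_degP H; apply/mpolyP => m; rewrite mcoeff_hcomp.
by case: eqP => [|/eqP /H ->]; rewrite ?mul1r ?mulr0.
Qed.

Lemma hcomp_ne d e p : homog_deg d p -> d != e -> hcomp e p = 0.
Proof.
move=> /homog_degP H de; apply/mpolyP => m; rewrite mcoeff_hcomp mcoeff0.
by case: eqP => [E|]; rewrite ?mul0r // H ?mulr0 // E eq_sym.
Qed.

Lemma homog0 d : homog_deg d (0 : S).
Proof. by apply/homog_degP => m _; rewrite mcoeff0. Qed.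

Lemma homogD d p q : homog_deg d p -> homog_deg d q -> homog_deg d (p + q).
Proof.
move=> /homog_degP H /homog_degP H'; apply/homog_degP => m E.
by rewrite mcoeffD H ?H' ?addr0.
Qed.

Lemma homogN d p : homog_deg d p -> homog_deg d (- p).
Proof.
by move=> /homog_degP H; apply/homog_degP => m E; rewrite mcoeffN H ?oppr0.
Qed.

Lemma homogB d p q : homog_deg d p -> homog_deg d q -> homog_deg d (p - q).
Proof. by move=> Hp Hq; apply: homogD => //; apply: homogN. Qed.

Lemma homog_sum d (I : Type) (r : seq I) (P : pred I) (F : I -> S) :
  (forall i, P i -> homog_deg d (F i)) -> homog_deg d (\sum_(i <- r | P i) F i).
Proof. by move=> H; apply: big_ind => //; [exact: homog0|exact: homogD]. Qed.

Lemma homogX m : homog_deg (mdeg m)%:Z ('X_[m] : S).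
Proof. by rewrite /= dhomogX. Qed.

Lemma homogM d e p q :
  homog_deg d p -> homog_deg e q -> homog_deg (d + e) (p * q).
Proof.
case: d => [d|d]; last by move=> /= ->; rewrite mul0r => _; apply: homog0.
case: e => [e|e]; last by move=> _ /= ->; rewrite mulr0; apply: homog0.
by move=> /= Hp Hq; apply: dhomogM.
Qed.

Lemma homog_eq d e p : homog_deg d p -> d = e -> homog_deg e p.
Proof. by move=> ? <-. Qed.

Lemma hcompM d e p q : homog_deg e q -> hcomp d (p * q) = hcomp (d - e) p * q.
Proof.
move=> hq; rewrite {1}[p]mpolyE [in RHS](mpolyE p) /hcomp mulr_suml !scale_coef_sum mulr_suml.
apply: eq_bigr => m _; rewrite -scalerAl !scale_coefZ -scalerAl; congr (_ *: _).
rewrite -/(hcomp d _) -/(hcomp (d - e) _).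
have hX := homogX m.
have [E|E] := eqVneq (mdeg m)%:Z (d - e).
  by rewrite hcomp_id ?hcomp_id -?E //; apply: homog_eq (homogM hX hq) _; lia.
rewrite (hcomp_ne hX E) mul0r (hcomp_ne (homogM hX hq)) //.
by apply: contra_neq E; lia.
Qed.

Lemma hcomp_sum d (I : Type) (r : seq I) (P : pred I) (F : I -> S) :
  hcomp d (\sum_(i <- r | P i) F i) = \sum_(i <- r | P i) hcomp d (F i).
Proof. exact: scale_coef_sum. Qed.

Lemma hcomp_partition (D : seq int) p : uniq D ->
  (forall m, m \in msupp p -> (mdeg m)%:Z \in D) -> \sum_(d <- D) hcomp d p = p.
Proof.
move=> uD HD; apply/mpolyP => m; rewrite raddf_sum /=.
under eq_bigr do rewrite mcoeff_hcomp.
have [mp|/memN_msupp_eq0 ->] := boolP (m \in msupp p); last first.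
  by rewrite big1 // => i _; rewrite mulr0.
rewrite (bigD1_seq (mdeg m)%:Z) ?HD //= eqxx mul1r big1 ?addr0 // => d.
by rewrite eq_sym => /negPf ->; rewrite mul0r.
Qed.

End ScaleCoef.

Section Vectors.
Variables (K : fieldType) (s r : nat).
Local Notation S := {mpoly K[s]}.
Implicit Types (sh : 'I_r -> int) (v : 'rV[S]_r).

Definition homog_vec sh (d : int) v := forall q, homog_deg (d - sh q) (v 0 q).
Definition hcomp_vec sh (d : int) v : 'rV[S]_r := \row_q hcomp (d - sh q) (v 0 q).

Lemma hcomp_vec_homog sh d v : homog_vec sh d (hcomp_vec sh d v).
Proof. by move=> q; rewrite mxE; apply: hcomp_homog. Qed.

Lemma hcomp_vec_id sh d v : homog_vec sh d v -> hcomp_vec sh d v = v.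
Proof. by move=> H; apply/rowP => q; rewrite mxE hcomp_id. Qed.

Lemma hcomp_vec_partition sh v :
  exists D : seq int, v = \sum_(d <- D) hcomp_vec sh d v.
Proof.
pose B := (\max_q msize (v ord0 q)).+1.
pose D := undup [seq sh q + (e : nat)%:Z | q <- enum 'I_r, e <- iota 0 B].
exists D.
apply/rowP => q; rewrite summxE; under eq_bigr do rewrite mxE.
rewrite -(big_map (fun d => d - sh q) xpredT (fun d => hcomp d (v 0 q))).
rewrite hcomp_partition //.
  by rewrite map_inj_uniq ?undup_uniq // => a b /addIr.
move=> m /msize_mdeg_lt mp.
apply/mapP; exists (sh q + (mdeg m)%:Z); last by rewrite addrC addKr.
rewrite mem_undup; apply/allpairsP; exists (q, mdeg m); split => //=;
  first by rewrite mem_enum.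
change (mdeg m \in iota 0 B); rewrite mem_iota /= add0n ltnS.
apply: ltnW (leq_trans mp _).
exact: (leq_bigmax (F := fun q => msize (v ord0 q))).
Qed.

End Vectors.

Section Graded.
Variables (K : fieldType) (s : nat).
Local Notation S := {mpoly K[s]}.

Definition homog_mx r1 r0 (sh1 : 'I_r1 -> int) (sh0 : 'I_r0 -> int)
  (M : 'M[S]_(r1, r0)) := forall p q, homog_deg (sh1 p - sh0 q) (M p q).

Lemma hcomp_vec_mul r1 r0 (sh1 : 'I_r1 -> int) (sh0 : 'I_r0 -> int)
    (M : 'M[S]_(r1, r0)) d (v : 'rV[S]_r1) :
  homog_mx sh1 sh0 M -> hcomp_vec sh0 d (v *m M) = hcomp_vec sh1 d v *m M.
Proof.
move=> hM; apply/rowP => q; rewrite !mxE hcomp_sum; apply: eq_bigr => p _.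
by rewrite mxE (hcompM _ _ (hM p q)); congr (hcomp _ _ * _); lia.
Qed.

Lemma homog_mx_mul r2 r1 r0 (sh2 : 'I_r2 -> int) (sh1 : 'I_r1 -> int)
    (sh0 : 'I_r0 -> int) (N : 'M[S]_(r2, r1)) (M : 'M[S]_(r1, r0)) :
  homog_mx sh2 sh1 N -> homog_mx sh1 sh0 M -> homog_mx sh2 sh0 (N *m M).
Proof.
move=> hN hM p q; rewrite mxE; apply: homog_sum => i _.
by apply: homog_eq (homogM (hN p i) (hM i q)) _; lia.
Qed.

(** Multiplication by a homogeneous matrix commutes with taking components, so the
    component of degree d of any lift is a lift. *)
Lemma lift_homog r1 r0 (sh1 : 'I_r1 -> int) (sh0 : 'I_r0 -> int)
    (M : 'M[S]_(r1, r0)) d (v : 'rV[S]_r1) (u : 'rV[S]_r0) :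
  homog_mx sh1 sh0 M -> homog_vec sh0 d u -> u = v *m M ->
  exists2 v', homog_vec sh1 d v' & u = v' *m M.
Proof.
move=> hM hu E; exists (hcomp_vec sh1 d v); first exact: hcomp_vec_homog.
by rewrite -(hcomp_vec_mul _ _ hM) -E hcomp_vec_id.
Qed.

End Graded.

(** * Existence of minimal graded free resolutions *)

(** Compare only the first k coordinates and use induction on k. If the finite
    set l0 dominates P in k coordinates, it still does so in k + 1 coordinates for
    the monomials whose new coordinate is at least its maximum B on l0; the
    others lie in the finitely many slices where the new coordinate is constant. *)
Lemma dickson n (P : 'X_{1..n} -> Prop) :
  exists2 l : seq 'X_{1..n}, (forall m, m \in l -> P m) &
    forall m, P m -> exists2 m', m' \in l & (m' <= m)%MM.
Proof.
suff H k : forall P : 'X_{1..n} -> Prop, exists2 l : seq 'X_{1..n},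
    (forall m, m \in l -> P m) & forall m, P m ->
    exists2 m', m' \in l & forall i : 'I_n, (i < k)%N -> (m' i <= m i)%N.
  have [l lP Pl] := H n P; exists l => // m /Pl[m' m'l le].
  by exists m' => //; apply/mnm_lepP => i; apply: le.
elim: k => [|k IH] {}P.
  have [[m0 Pm0]|nP] := pselect (exists m, P m).
    exists [:: m0] => m; first by rewrite inE => /eqP ->.
    by exists m0; rewrite ?inE.
  by exists [::] => // m Pm; case: nP; exists m.
have [nk|kn] := leqP n k.
  have [l lP Pl] := IH P; exists l => // m /Pl[m' m'l le]; exists m' => // i _.
  by apply: le; apply: leq_trans nk.
pose i0 := Ordinal kn.
have [l0 l0P Pl0] := IH P.
pose B := (\max_(m <- l0) m i0)%N.
have [l lP Pl] : exists2 l : seq 'X_{1..n}, (forall m, m \in l -> P m) &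
    forall m, P m -> (m i0 < B)%N ->
    exists2 m', m' \in l & forall i : 'I_n, (i < k.+1)%N -> (m' i <= m i)%N.
  elim: B => [|B [l lP Pl]]; first by exists [::].
  have [lB lBP PlB] := IH (fun m => P m /\ m i0 = B).
  exists (l ++ lB) => m; first by rewrite mem_cat => /orP[/lP //|/lBP[]].
  move=> Pm; rewrite ltnS leq_eqVlt => /predU1P[mB|mB]; last first.
    by have [m' m'l ?] := Pl _ Pm mB; exists m' => //; rewrite mem_cat m'l.
  have [m' m'l le] := PlB _ (conj Pm mB).
  exists m'; first by rewrite mem_cat m'l orbT.
  move=> i; rewrite ltnS leq_eqVlt => /predU1P[ik|/le//].
  have -> : i = i0 by apply: val_inj.
  by rewrite mB; have [_ ->] := lBP _ m'l.
exists (l0 ++ l) => m; first by rewrite mem_cat => /orP[/l0P|/lP].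
move=> Pm; have [mB|Bm] := ltnP (m i0) B.
  by have [m' m'l ?] := Pl _ Pm mB; exists m' => //; rewrite mem_cat m'l orbT.
have [m' m'l le] := Pl0 _ Pm.
exists m'; first by rewrite mem_cat m'l.
move=> i; rewrite ltnS leq_eqVlt => /predU1P[ik|/le//].
have -> : i = i0 by apply: val_inj.
by apply: leq_trans Bm; rewrite /B (big_rem _ m'l) /= leq_maxl.
Qed.

Section Noether.
Variables (K : fieldType) (s : nat).
Local Notation S := {mpoly K[s]}.

(** Elements of J whose leading monomials dominate those of all of J generate J:
    one division step lowers the leading monomial, and the order is well-founded. *)
Lemma hilbert_basis (J : S -> Prop) :
    (forall a f g, J f -> J g -> J (a * f + g)) ->
  exists m (g : 'I_m -> S), (forall i, J (g i)) /\
    forall f, J f -> exists c : 'I_m -> S, f = \sum_i c i * g i.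
Proof.
move=> Jlin.
have [l lP Pl] := dickson (fun m => exists2 f, J f & f != 0 /\ mlead f = m).
have /fin_all_exists[g gP] : forall i : 'I_(size l),
    exists f, [/\ J f, f != 0 & mlead f = nth 0%MM l i].
  by move=> i; have [f ? []] := lP _ (mem_nth 0%MM (ltn_ord i)); exists f.
exists (size l), g; split=> [i|]; first by case: (gP i).
suff H : forall m f, J f -> mlead f = m ->
    exists c : 'I_(size l) -> S, f = \sum_i c i * g i.
  by move=> f Jf; apply: (H _ _ Jf erefl).
apply: ltmwf => m IH f Jf fm.
have [->|f0] := eqVneq f 0.
  by exists (fun=> 0); rewrite big1 // => i _; rewrite mul0r.
have [m' m'l le] := Pl m (ex_intro2 _ _ f Jf (conj f0 fm)).
have im : (index m' l < size l)%N by rewrite index_mem.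
pose i := Ordinal im; have [Jg g0] := gP i; rewrite nth_index // => gm.
pose a : S := (f@_m / (g i)@_m') *: 'X_[m - m'].
have lg : (g i)@_m' != 0 by rewrite -gm mleadc_eq0.
have lf : f@_m != 0 by rewrite -fm mleadc_eq0.
have X0 : 'X_[m - m'] != 0 :> S.
  by apply/eqP => /(congr1 (mcoeff (m - m')%MM)); rewrite mcoeffX eqxx mcoeff0 => /eqP; rewrite oner_eq0.
have Ea : mlead (a * g i) = m.
  rewrite -scalerAl mleadZ ?mulf_neq0 ?invr_eq0 // mleadM //.
  by rewrite mleadXm gm submK.
have Ca : (a * g i)@_m = f@_m.
  by rewrite -scalerAl mcoeffZ -{2}(submK le) ['X_[_] * _]mulrC mcoeffMX divfK.
pose q := (- a) * g i + f.
have Jq : J q by apply: Jlin.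
suff [c Ec] : exists c : 'I_(size l) -> S, q = \sum_i c i * g i.
  exists (fun j => c j + (if j == i then a else 0)).
  under eq_bigr do rewrite mulrDl.
  rewrite big_split /= -Ec (bigD1 i) //= eqxx big1 => [|j /negPf ->]; last by rewrite mul0r.
  by rewrite addr0 /q mulNr addrAC addNr add0r.
have [->|q0] := eqVneq q 0.
  by exists (fun=> 0); rewrite big1 // => j _; rewrite mul0r.
apply: (IH (mlead q)) => //; rewrite lt_neqAle; apply/andP; split.
  have : q@_(mlead q) != 0 by rewrite mleadc_eq0.
  by apply: contraNneq => ->; rewrite /q mulNr mcoeffD mcoeffN Ca addNr.
have := mleadD_le (- a * g i) f; rewrite -/q mulNr mleadN Ea fm.
by rewrite joinxx.
Qed.

Definition rowspan m r (M : 'M[S]_(m, r)) (u : 'rV[S]_r) := exists v, u = v *m M.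

Lemma rowspan_lin m r (M : 'M[S]_(m, r)) a u v :
  rowspan M u -> rowspan M v -> rowspan M (a *: u + v).
Proof.
by move=> [u' ->] [v' ->]; exists (a *: u' + v'); rewrite mulmxDl scalemxAl.
Qed.

Lemma rowspan0 m r (M : 'M[S]_(m, r)) : rowspan M 0.
Proof. by exists 0; rewrite mul0mx. Qed.

Lemma rowspanZ m r (M : 'M[S]_(m, r)) a u : rowspan M u -> rowspan M (a *: u).
Proof. by move=> H; rewrite -[_ *: _]addr0; apply: rowspan_lin => //; apply: rowspan0. Qed.

Lemma rowspan_sum m r (M : 'M[S]_(m, r)) (I : eqType) (l : seq I)
    (F : I -> 'rV[S]_r) :
  (forall i, i \in l -> rowspan M (F i)) -> rowspan M (\sum_(i <- l) F i).
Proof.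
move=> H; rewrite big_seq; apply: big_ind => //; first exact: rowspan0.
by move=> x y Hx Hy; rewrite -[x]scale1r; apply: rowspan_lin.
Qed.

Lemma rowspan_row m r (M : 'M[S]_(m, r)) i : rowspan M (row i M).
Proof. by exists (delta_mx 0 i); rewrite rowE. Qed.

Lemma rowspan_sub m m' r (M : 'M[S]_(m, r)) (M' : 'M[S]_(m', r)) u :
  (forall i, rowspan M (row i M')) -> rowspan M' u -> rowspan M u.
Proof.
move=> H [v ->]; rewrite mulmx_sum_row; apply: rowspan_sum => i _; exact: rowspanZ.
Qed.

Definition submodule r (N : 'rV[S]_r -> Prop) :=
  N 0 /\ forall a u v, N u -> N v -> N (a *: u + v).

Lemma submodule_rowspan m r (M : 'M[S]_(m, r)) N u :
  submodule N -> (forall i, N (row i M)) -> rowspan M u -> N u.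
Proof.
move=> [N0 Nlin] H [v ->]; rewrite mulmx_sum_row; apply: big_ind => //.
  by move=> x y Hx Hy; rewrite -[x]scale1r; apply: Nlin.
by move=> i _; rewrite -[_ *: _]addr0; apply: Nlin.
Qed.

(** The induction is on the number k of coordinates in which N may be nonzero: the
    values of the last of these form an ideal, and the elements where it
    vanishes form a smaller submodule. *)
Lemma submodule_fgen r (N : 'rV[S]_r -> Prop) : submodule N ->
  exists m (M : 'M[S]_(m, r)), forall u, N u <-> rowspan M u.
Proof.
suff H k : forall N : 'rV[S]_r -> Prop, submodule N ->
    (forall u, N u -> forall q : 'I_r, (k <= q)%N -> u 0 q = 0) ->
    exists m (M : 'M[S]_(m, r)), forall u, N u <-> rowspan M u.
  by move=> sN; apply: (H r) => // u _ q; rewrite leqNgt ltn_ord.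
elim: k => [|k IH] {}N sN Nz; have [N0 Nlin] := sN.
  exists 0%N, 0 => u; split=> [Nu|[v ->]]; last by rewrite mulmx0.
  by exists 0; rewrite mul0mx; apply/rowP => q; rewrite mxE (Nz u).
have [rk|kr] := leqP r k.
  by apply: IH => // u _ q kq; have := leq_trans rk kq; rewrite leqNgt ltn_ord.
pose q0 := Ordinal kr.
pose J f := exists2 u, N u & u 0 q0 = f.
have [|m [g [gJ Jg]]] := @hilbert_basis J.
  move=> a f g [u Nu uf] [v Nv vg]; exists (a *: u + v); first exact: Nlin.
  by rewrite !mxE uf vg.
have /fin_all_exists2[w wN wg] := gJ.
pose G : 'M[S]_(m, r) := \matrix_i w i.
have [||n [M HM]] := IH (fun u => N u /\ u 0 q0 = 0).
- split=> [|a u v [Nu u0] [Nv v0]]; first by split=> //; rewrite mxE.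
  by split; [apply: Nlin|rewrite !mxE u0 v0 mulr0 addr0].
- move=> u [Nu u0] q; rewrite leq_eqVlt => /predU1P[kq|]; last exact: Nz.
  by have <- : q0 = q by apply: val_inj.
exists (m + n)%N, (col_mx G M) => u; split=> [Nu|].
  have [c Ec] := Jg _ (ex_intro2 _ _ u Nu erefl).
  pose c' : 'rV_m := \row_i c i.
  have NG : N (c' *m G).
    by apply: (submodule_rowspan sN) (ex_intro _ _ erefl) => i; rewrite rowK.
  have /HM[d Ed] : N (u - c' *m G) /\ (u - c' *m G) 0 q0 = 0.
    split; first by rewrite addrC -scaleN1r; apply: Nlin.
    rewrite !mxE; apply/eqP; rewrite subr_eq0; apply/eqP; rewrite Ec.
    by apply: eq_bigr => i _; rewrite !mxE wg.
  by exists (row_mx c' d); rewrite mul_row_col -Ed addrC subrK.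
apply: submodule_rowspan => // i; rewrite -[i]splitK; case: (split i) => j /=.
  by rewrite rowKu rowK.
by rewrite rowKd; have /HM[] := rowspan_row M j.
Qed.

Definition graded r (sh : 'I_r -> int) (N : 'rV[S]_r -> Prop) :=
  forall d u, N u -> N (hcomp_vec sh d u).

Lemma homog_gens r (sh : 'I_r -> int) (N : 'rV[S]_r -> Prop) :
  submodule N -> graded sh N ->
  exists m (sh1 : 'I_m -> int) (D : 'M[S]_(m, r)),
    homog_mx sh1 sh D /\ forall u, N u <-> rowspan D u.
Proof.
move=> sN gN; have [n [G HG]] := submodule_fgen sN.
have /fin_all_exists[T ET] i := hcomp_vec_partition sh (row i G).
pose L := flatten [seq [seq (d, hcomp_vec sh d (row i G)) | d <- T i] | i <- enum 'I_n].
pose nL (i : 'I_(size L)) := nth (0, 0) L i.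
have LP x : x \in L -> exists i d, x = (d, hcomp_vec sh d (row i G)).
  by move=> /flatten_mapP[i _ /mapP[d _ ->]]; exists i, d.
exists (size L), (fun i => (nL i).1), (\matrix_i (nL i).2).
have sD i d : d \in T i -> rowspan (\matrix_i (nL i).2) (hcomp_vec sh d (row i G)).
  move=> dT; have xL : (d, hcomp_vec sh d (row i G)) \in L.
    by apply/flatten_mapP; exists i; rewrite ?mem_enum //; apply: map_f.
  have xs := xL; rewrite -index_mem in xs.
  have := rowspan_row (\matrix_i (nL i).2) (Ordinal xs).
  by rewrite rowK /nL nth_index.
split.
  move=> p q; rewrite mxE /nL; have /LP[i [d ->]] := mem_nth (0, 0) (ltn_ord p).
  exact: hcomp_vec_homog.
move=> u; split=> [/HG|].
  by apply: rowspan_sub => i; rewrite ET; apply: rowspan_sum => d /sD.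
apply: submodule_rowspan => // i; rewrite rowK /nL.
have /LP[j [d ->]] /= := mem_nth (0, 0) (ltn_ord i).
by apply: gN; apply/HG; apply: rowspan_row.
Qed.

(** In a generating family of least size no generator is a combination of the
    others, whereas the homogeneous part of a relation with a nonzero constant in
    position p would express the generator p in this way. *)
Lemma minimal_gens r (sh : 'I_r -> int) (N : 'rV[S]_r -> Prop) :
  submodule N -> graded sh N ->
  exists m (sh1 : 'I_m -> int) (D : 'M[S]_(m, r)),
    [/\ homog_mx sh1 sh D, forall u, N u <-> rowspan D u &
      forall u : 'rV_m, u *m D = 0 -> forall p, (u 0 p)@_0%MM = 0].
Proof.
move=> sN gN.
pose P m := exists (sh1 : 'I_m -> int) (D : 'M[S]_(m, r)),
  homog_mx sh1 sh D /\ forall u, N u <-> rowspan D u.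
have exP : exists m, `[< P m >].
  by have [m Pm] := homog_gens sN gN; exists m; apply/asboolP.
have [m /asboolP[sh1 [D [hD ND]]] minm] := ex_minnP exP.
exists m, sh1, D; split=> // u uD p; apply/eqP; apply: contraT => up.
case: m p sh1 D u minm hD ND uD up => [|k] p; first by case: p.
move=> sh1 D u minm hD ND uD up.
suff : `[< P k >] by move/minm; rewrite ltnn.
apply/asboolP; exists (fun j => sh1 (lift p j)), (row' p D); split.
  by move=> i j; rewrite !mxE; apply: hD.
have rowspan' j : rowspan (row' p D) (row (lift p j) D).
  by have := rowspan_row (row' p D) j; congr rowspan; apply/rowP => q; rewrite !mxE.
have spanp : rowspan (row' p D) (row p D).
  pose u' := hcomp_vec sh1 (sh1 p) u.
  have : u' *m D = 0.
    by rewrite -(hcomp_vec_mul _ _ hD) uD; apply: hcomp_vec_id => q; rewrite mxE; apply: homog0.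
  rewrite mulmx_sum_row (bigD1_ord p) //=.
  have -> : u' 0 p = ((u 0 p)@_0%MM)%:MP.
    apply/mpolyP => m; rewrite mxE subrr mcoeff_hcomp mcoeffC eqz_nat mdeg_eq0.
    by case: eqP => [->|]; rewrite ?mul1r ?mulr1 ?mul0r ?mulr0.
  move/eqP; rewrite addr_eq0 => /eqP E.
  have -> : row p D = ((u 0 p)@_0%MM)^-1%:MP *: (((u 0 p)@_0%MM)%:MP *: row p D).
    by rewrite scalerA -mpolyCM mulVf // scale1r.
  rewrite E; apply: rowspanZ; rewrite -scaleN1r; apply: rowspanZ.
  by apply: rowspan_sum => j _; apply: rowspanZ.
move=> v; split=> [/ND|].
  apply: rowspan_sub => i; have [j ->|->] := unliftP p i; [exact: rowspan'|exact: spanp].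
apply: submodule_rowspan => // i.
suff -> : row i (row' p D) = row (lift p i) D by apply/ND; apply: rowspan_row.
by apply/rowP => q; rewrite !mxE.
Qed.

(** The submodule that the next step of a resolution has to cover, together with
    the graded free module that contains it. Packing both makes the types of
    consecutive differentials match by computation. *)
Record stage := Stage {
  st_r : nat;
  st_sh : 'I_st_r -> int;
  st_N : 'rV[S]_st_r -> Prop;
  st_submod : submodule st_N;
  st_graded : graded st_sh st_N
}.

Lemma stage_cover (T : stage) : exists (T' : stage) (D : 'M[S]_(st_r T', st_r T)),
  [/\ homog_mx (@st_sh T') (@st_sh T) D, forall u, st_N u <-> rowspan D u,
     (forall v : 'rV_(st_r T'), st_N v <-> v *m D = 0) &
     forall v : 'rV_(st_r T'), st_N v -> forall p, (v 0 p)@_0%MM = 0].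
Proof.
case: T => r sh N sN gN /=.
have [m [sh1 [D [hD ND minD]]]] := minimal_gens sN gN.
have sk : submodule (fun v => v *m D = 0).
  split=> [|a u v Hu Hv]; first by rewrite mul0mx.
  by rewrite mulmxDl -scalemxAl Hu Hv scaler0 addr0.
have gk : graded sh1 (fun v => v *m D = 0).
  move=> d v Hv; rewrite -(hcomp_vec_mul _ _ hD) Hv; apply: hcomp_vec_id => q.
  by rewrite mxE; apply: homog0.
by exists (Stage sk gk), D.
Qed.

Lemma exists_min_resolution (I : set S) :
  submodule (fun v : 'rV_1 => I (v 0 0)) ->
  (forall d f, I f -> I (hcomp d f)) ->
  exists F : free_seq K s, minimal_graded_free_resolution F I.
Proof.
move=> sI gI.
have gI' : graded (fun _ : 'I_1 => 0) (fun v : 'rV_1 => I (v 0 0)).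
  by move=> d u; rewrite mxE; apply: gI.
pose next T := cid (stage_cover T).
pose T := fix T i := if i is j.+1 then sval (next (T j)) else Stage sI gI'.
pose D i := cid (svalP (next (T i))).
pose F := @FreeSeq K s (fun i => st_r (T i.+1)) (fun i => @st_sh (T i.+1))
  (fun i => sval (D i.+1)) (sval (D 0%N)).
exists F; have DP i := svalP (D i); split.
- split=> [p|i p q]; last by have [+ _ _ _] := DP i.+1; apply.
  by have [/(_ p 0) + _ _ _] := DP 0%N; rewrite subr0.
- move=> f; have [_ H _ _] := DP 0%N; have {}H := H (\row__ f).
  rewrite /= mxE in H; rewrite H; split=> -[u Eu]; exists u.
    by have := congr1 (fun A : 'rV_1 => A 0 0) Eu; rewrite mxE.
  by apply/rowP => j; rewrite mxE Eu ord1.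
- split=> [u|i u].
    have [_ _ <- _] := DP 0%N; have [_ H _ _] := DP 1%N; exact: H.
  have [_ _ <- _] := DP i.+1; have [_ H _ _] := DP i.+2; exact: H.
- move=> i p q; have [_ _ _ /(_ (row p (sval (D i.+1))))] := DP i.
  move=> /(_ _ q); rewrite mxE; apply.
  by have [_ H _ _] := DP i.+1; apply/H; apply: rowspan_row.
Qed.

End Noether.

(** * Linear quotients *)

Section LinearQuotients.
Variables (K : fieldType) (s : nat).
Local Notation S := {mpoly K[s]}.

(** Membership in the ideal generated by the variables of A, expressed by
    monomials: it is checked one coefficient at a time. *)
Definition var_ideal (A : {set 'I_s}) (f : S) :=
  forall m, f@_m != 0 -> exists2 a, a \in A & m a != 0%N.

Lemma var_ideal_ind (A : {set 'I_s}) (P : S -> Prop) f :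
    P 0 -> (forall a g h, P g -> P h -> P (a * g + h)) ->
    (forall a, a \in A -> P 'X_a) ->
  var_ideal A f -> P f.
Proof.
move=> P0 Plin PX Af; rewrite [f]mpolyE big_seq.
apply: big_ind => //; first by move=> x y; rewrite -{2}[x]mul1r; apply: Plin.
move=> m; rewrite mcoeff_msupp => /Af[a aA ma].
have le : (U_(a) <= m)%MM by rewrite lep1mP.
by rewrite -(submK le) mpolyXD scalerAl -[_ * _]addr0; apply: Plin => //; apply: PX.
Qed.

(** The multipliers that take the row k of L into the span of the rows that precede
    it in the order o are required to form the ideal of the variables of A k. Such
    a multiplier is the leading coefficient f of a relation c; in this form the
    property depends only on the relations between the rows. *)
Definition linear_quotients m r (L : 'M[S]_(m, r)) :=
  exists (o : 'I_m -> nat) (A : 'I_m -> {set 'I_s}), injective o /\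
    forall k f,
      (exists c : 'rV_m, [/\ c *m L = 0, c 0 k = f &
                             forall j, (o k < o j)%N -> c 0 j = 0])
      <-> var_ideal (A k) f.

(** For a in A k there is a relation rho (k, a) with leading coefficient 'X_a at
    k. Cancelling leading coefficients shows that these generate all relations.
    Ordered by k and then by a, they have linear quotients: a multiple f of
    rho (k, a) is in the span of the earlier ones only if f 'X_a is in the ideal of
    the earlier variables of A k, hence f is. Conversely, for such a variable a',
    the difference of 'X_a' rho (k, a) and 'X_a rho (k, a') is a relation supported
    strictly before k, so it is a combination of the relations with index before
    k. *)
Lemma linear_quotients_syzygies m r (sh : 'I_r -> int) d (L : 'M[S]_(m, r)) :
    homog_mx (fun=> d) sh L -> linear_quotients L ->
  exists m1 (M : 'M[S]_(m1, m)),
    [/\ homog_mx (fun=> d + 1) (fun=> d) M,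
        forall u : 'rV_m, u *m L = 0 <-> rowspan M u & linear_quotients M].
Proof.
move=> hL [o [A [oI LQ]]].
have /fin_all_exists[rho rhoP] : forall x : 'I_m * 'I_s, exists c : 'rV[S]_m,
    x.2 \in A x.1 -> [/\ c *m L = 0, c 0 x.1 = 'X_(x.2),
      forall j, (o x.1 < o j)%N -> c 0 j = 0 & forall q, homog_deg 1%R (c 0 q)].
  move=> [k a] /=; have [aA|] := boolP (a \in A k); last by exists 0.
  have /LQ[c [cL ck cz]] : var_ideal (A k) 'X_a.
    move=> m'; rewrite mcoeffX; have [<- _|_] := eqVneq U_(a)%MM m'; last by rewrite eqxx.
    by exists a => //; rewrite mnm1E eqxx.
  exists (hcomp_vec (fun=> d) (d + 1) c) => _; split.
  - by rewrite -(hcomp_vec_mul _ _ hL) cL; apply: hcomp_vec_id => q; rewrite mxE; apply: homog0.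
  - rewrite mxE ck; apply: hcomp_id; have := homogX K U_(a)%MM.
    by rewrite mdeg1 addrC addKr.
  - by move=> j /cz; rewrite mxE => ->; apply: hcomp_id; apply: homog0.
  - by move=> q; rewrite mxE [d + 1]addrC addrK; exact: (hcomp_homog 1%R).
pose E := [set x : 'I_m * 'I_s | x.2 \in A x.1].
pose ev (t : 'I_#|E|) := enum_val t.
have evP t : (ev t).2 \in A (ev t).1 by have := enum_valP t; rewrite inE.
pose M : 'M[S]_(#|E|, m) := \matrix_t rho (ev t).
have rowM t : row t M = rho (ev t) by rewrite rowK.
have ML : M *m L = 0.
  apply/row_matrixP => t; rewrite row_mul rowM row0.
  by have [] := rhoP _ (evP t).
have Mz t j : (o (ev t).1 < o j)%N -> M t j = 0.
  by move=> H; rewrite mxE; have [_ _ -> //] := rhoP _ (evP t).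
have Md t : M t (ev t).1 = 'X_((ev t).2).
  by rewrite mxE; have [] := rhoP _ (evP t).
(* The support is tracked because the converse inclusion of the linear quotients
   below needs a combination of earlier relations only. *)
have gen N : forall u : 'rV_m, u *m L = 0 ->
    (forall j, (N <= o j)%N -> u 0 j = 0) ->
    exists2 v : 'rV_#|E|, u = v *m M & forall t, (N <= o (ev t).1)%N -> v 0 t = 0.
  elim: N => [|N IH] u uL uz.
    exists 0; last by move=> t _; rewrite mxE.
    by rewrite mul0mx; apply/rowP => j; rewrite mxE uz.
  have [[k ok]|nk] := pselect (exists k, o k = N); last first.
    have [||v -> vz] := IH u => //.
      by move=> j; rewrite leq_eqVlt => /predU1P[E1|/uz//]; case: nk; exists j.
    by exists v => // t /ltnW /vz.
  have /LQ : exists c : 'rV_m, [/\ c *m L = 0, c 0 k = u 0 k &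
      forall j, (o k < o j)%N -> c 0 j = 0].
    by exists u; split=> // j; rewrite ok => /uz.
  pose P f := exists2 v : 'rV_#|E|, (v *m M) 0 k = f &
    forall t, (ev t).1 != k -> v 0 t = 0.
  have H : var_ideal (A k) (u 0 k) -> P (u 0 k).
    apply: var_ideal_ind => {uL uz u}.
    - by exists 0 => [|t _]; rewrite ?mul0mx mxE.
    - move=> a g h [v vg vz] [w wh wz]; exists (a *: v + w).
        by rewrite mulmxDl -scalemxAl mxE [X in X + _]mxE vg wh.
      by move=> t tk; rewrite !mxE vz ?wz // mulr0 addr0.
    - move=> a aA; have tE : (k, a) \in E by rewrite inE.
      pose t := enum_rank_in tE (k, a).
      have et : ev t = (k, a) by rewrite /ev enum_rankK_in.
      exists (delta_mx 0 t).
        by rewrite -rowE mxE; have := Md t; rewrite et.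
      move=> t' tk; rewrite mxE /=; case: (eqVneq t' t) => // E1.
      by rewrite E1 et eqxx in tk.
  move=> /H[v vk vz].
  have [||w Ew wz] := IH (u - v *m M).
  - by rewrite mulmxBl uL -mulmxA ML mulmx0 subr0.
  - move=> j; rewrite leq_eqVlt => /predU1P[E1|lt].
      have -> : j = k by apply: oI; rewrite ok.
      by rewrite mxE [X in _ + X]mxE vk subrr.
    rewrite mxE [X in _ + X]mxE uz // add0r mxE big1 ?oppr0 // => t _.
    have [E1|/vz ->] := eqVneq (ev t).1 k; last by rewrite mul0r.
    by rewrite Mz ?mulr0 // E1 ok.
  exists (v + w); first by rewrite mulmxDl -Ew addrC subrK.
  move=> t lt; rewrite mxE wz ?addr0; last exact: ltnW.
  by apply: vz; apply: contraTneq lt => ->; rewrite ok ltnn.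
exists #|E|, M; split.
- by move=> t q; rewrite mxE addrC addKr; have [] := rhoP _ (evP t).
- move=> u; split=> [uL|[v ->]]; last by rewrite -mulmxA ML mulmx0.
  pose N := (\max_j o j).+1.
  have [|v Ev _] := gen N u uL; last by exists v.
  by move=> j; rewrite leqNgt ltnS (leq_bigmax j).
pose o1 t := (o (ev t).1 * s + (ev t).2)%N.
have o1lt t t' : (o (ev t).1 < o (ev t').1)%N -> (o1 t < o1 t')%N.
  move=> lt; rewrite /o1; apply: (@leq_trans ((o (ev t).1).+1 * s)).
    by rewrite mulSn addnC ltn_add2r.
  by apply: leq_trans (leq_addr _ _); rewrite leq_mul2r lt orbT.
have o1I : injective o1.
  move=> t t' E1; apply: enum_val_inj.
  have o12 : o (ev t).1 = o (ev t').1.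
    by case: (ltngtP (o (ev t).1) (o (ev t').1)) => // /o1lt; rewrite E1 ltnn.
  apply/eqP; rewrite -pair_eqE /pair_eq /=; apply/andP; split; first by apply/eqP/oI.
  by move/eqP: E1; rewrite /o1 o12 eqn_add2l.
exists o1, (fun t => [set a in A (ev t).1 | (a < (ev t).2)%N]); split=> // t f.
split.
  move=> [c [cM ct cz]] m' fm'.
  apply: contrapT => nA.
  have mz a : a \in A (ev t).1 -> (a < (ev t).2)%N -> m' a = 0%N.
    move=> aA lt; apply/eqP; apply: contrapT => /negP ma.
    by apply: nA; exists a => //; rewrite inE aA.
  have := congr1 (fun B : 'rV_m => (B 0 (ev t).1)@_(U_((ev t).2) + m')) cM.
  rewrite /= !mxE mcoeff0 raddf_sum (bigD1 t) //= big1 ?addr0.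
    rewrite ct Md mulrC mcoeff_mulXm lem_addr addmC addmK => E1.
    by rewrite E1 eqxx in fm'.
  move=> t' tt'.
  have [lt|le] := ltnP (o1 t) (o1 t'); first by rewrite cz // mul0r mcoeff0.
  have lt' : (o1 t' < o1 t)%N.
    by rewrite ltn_neqAle le andbT; apply: contra_neq tt' => /o1I.
  have [lt''|] := ltnP (o (ev t').1) (o (ev t).1); first by rewrite Mz // mulr0 mcoeff0.
  rewrite leq_eqVlt => /predU1P[/oI E1|/o1lt]; last by rewrite ltnNge le.
  rewrite E1 Md mulrC mcoeff_mulXU mnmDE mnm1E.
  have lta : ((ev t').2 < (ev t).2)%N by move: lt'; rewrite /o1 E1 ltn_add2l.
  have -> : ((ev t).2 == (ev t').2) = false by rewrite -val_eqE gtn_eqF.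
  by rewrite mz // E1.
apply: (var_ideal_ind (P := fun f => exists c : 'rV_#|E|,
  [/\ c *m M = 0, c 0 t = f & forall j, (o1 t < o1 j)%N -> c 0 j = 0])).
- by exists 0; split; rewrite ?mul0mx ?mxE // => j _; rewrite mxE.
- move=> a g h [v [vM vg vz]] [w [wM wh wz]]; exists (a *: v + w); split.
  + by rewrite mulmxDl -scalemxAl vM wM scaler0 addr0.
  + by rewrite !mxE vg wh.
  + by move=> j lt; rewrite !mxE vz ?wz // mulr0 addr0.
move=> a; rewrite inE => /andP[aA lta].
have tE : ((ev t).1, a) \in E by rewrite inE.
pose t' := enum_rank_in tE ((ev t).1, a).
have et : ev t' = ((ev t).1, a) by rewrite /ev enum_rankK_in.
have lt' : (o1 t' < o1 t)%N by rewrite /o1 et /= ltn_add2l.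
have nt : t' != t by apply: contraTneq lt' => ->; rewrite ltnn.
pose u := 'X_a *: row t M - 'X_((ev t).2) *: row t' M.
have uE j : u 0 j = 'X_a * M t j - 'X_((ev t).2) * M t' j by rewrite !mxE.
have [||v Ev vz] := gen (o (ev t).1) u.
- by rewrite mulmxBl -!scalemxAl -!row_mul ML !row0 !scaler0 subr0.
- move=> j; rewrite uE leq_eqVlt => /predU1P[/oI <-|lt].
    by rewrite Md; have := Md t'; rewrite et /= => ->; rewrite mulrC subrr.
  by rewrite !Mz ?et // !mulr0 subr0.
exists ('X_a *: delta_mx 0 t - 'X_((ev t).2) *: delta_mx 0 t' - v); split.
- by rewrite !mulmxBl -!scalemxAl -!rowE -Ev subrr.
- by rewrite !mxE !eqxx [t == t']eq_sym (negPf nt) /= vz // mulr0 mulr1 !subr0.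
move=> t2 lt2; rewrite !mxE /=.
have /negPf -> : t2 != t by apply: contraTneq lt2 => ->; rewrite ltnn.
have /negPf -> : t2 != t'.
  by apply: contraTneq lt2 => ->; rewrite -leqNgt ltnW.
rewrite vz ?mulr0 ?subr0 // leqNgt; apply: contraTN lt2 => /o1lt.
by rewrite -leqNgt => /ltnW.
Qed.

Lemma linear_quotients_mulr m r r' (L : 'M[S]_(m, r)) (P : 'M[S]_(r, r')) Q :
  P *m Q = 1%:M -> linear_quotients L -> linear_quotients (L *m P).
Proof.
move=> PQ [o [A [oI LQ]]]; exists o, A; split=> // k f; rewrite -LQ.
split=> -[c [cL cf cz]]; exists c; split=> //.
  by rewrite -[c *m L]mulmx1 -PQ !mulmxA -(mulmxA c) cL mul0mx.
by rewrite mulmxA cL mul0mx.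
Qed.

Lemma homog_degree0_eq0 (f : S) : homog_deg 0%R f -> f@_0%MM = 0 -> f = 0.
Proof.
move=> /homog_degP H f0; apply/mpolyP => m; rewrite mcoeff0.
have [->//|m0] := eqVneq m 0%MM.
by apply: H; rewrite eqz_nat mdeg_eq0.
Qed.

Lemma homog_const (f : S) d : homog_deg d f -> d != 0 -> f@_0%MM = 0.
Proof. by move=> /homog_degP H d0; apply: H; rewrite mdeg0 eq_sym. Qed.

Lemma mcoeff0_mulmx m n r (A : 'M[S]_(m, n)) (B : 'M[S]_(n, r)) i j :
  ((A *m B) i j)@_0%MM = \sum_k (A i k)@_0%MM * (B k j)@_0%MM.
Proof. by rewrite mxE raddf_sum; apply: eq_bigr => k _; rewrite /= rmorphM. Qed.

Lemma homog_mx1 n d : homog_mx (fun=> d) (fun=> d) (1%:M : 'M[S]_n).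
Proof.
move=> i j; rewrite mxE subrr; case: eqP => _ /=; last exact: dhomog0.
exact: dhomog1.
Qed.

(** Let L = P D and D = Q L with homogeneous P and Q. The relations of L are
    generated by linear ones, so they have no constant coefficients, and those of
    D have none by minimality. Therefore P Q and Q P are the identity modulo the
    variables. The
    diagonal of Q P then forces each degree of D to be d, the entries of
    P and Q are constants, and P, Q are inverse to each other. Hence the linear
    quotients of the relations of L pass to those of D. *)
Lemma linear_quotients_min_cover m r m' (sh : 'I_r -> int) (sh' : 'I_m' -> int) d
    (L : 'M[S]_(m, r)) (D : 'M[S]_(m', r)) :
    homog_mx (fun=> d) sh L -> linear_quotients L -> homog_mx sh' sh D ->
    (forall u, rowspan L u <-> rowspan D u) ->
    (forall u : 'rV_m', u *m D = 0 -> forall p, (u 0 p)@_0%MM = 0) ->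
  (forall p, sh' p = d) /\
  exists m1 (L1 : 'M[S]_(m1, m')),
    [/\ homog_mx (fun=> d + 1) sh' L1, linear_quotients L1 &
        forall u : 'rV_m', u *m D = 0 <-> rowspan L1 u].
Proof.
move=> hL lqL hD LD minD.
have [m1 [M [hM kM lqM]]] := linear_quotients_syzygies hL lqL.
have /fin_all_exists2[P0 hP EP] : forall k, exists2 v, homog_vec sh' d v & row k L = v *m D.
  move=> k; have [v Ev] : rowspan D (row k L) by apply/LD; apply: rowspan_row.
  by apply: lift_homog hD _ Ev => q; rewrite mxE; apply: hL.
have /fin_all_exists2[Q0 hQ EQ] : forall k, exists2 v, homog_vec (fun=> d) (sh' k) v & row k D = v *m L.
  move=> k; have [v Ev] : rowspan L (row k D) by apply/LD; apply: rowspan_row.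
  by apply: lift_homog hL _ Ev => q; rewrite mxE; apply: hD.
pose P := \matrix_k P0 k; pose Q := \matrix_k Q0 k.
have LP : L = P *m D by apply/row_matrixP => k; rewrite row_mul rowK.
have DQ : D = Q *m L by apply/row_matrixP => k; rewrite row_mul rowK.
have {}hP : homog_mx (fun=> d) sh' P by move=> k q; rewrite mxE; apply: hP.
have {}hQ : homog_mx sh' (fun=> d) Q by move=> k q; rewrite mxE; apply: hQ.
have QP0 i j : ((Q *m P - 1%:M) i j)@_0%MM = 0.
  have := minD (row i (Q *m P - 1%:M)); rewrite -row_mul mulmxBl -mulmxA -LP -DQ mul1mx.
  by rewrite subrr row0 => /(_ erefl j); rewrite mxE.
have PQ : P *m Q = 1%:M.
  apply/eqP; rewrite -subr_eq0; apply/eqP/matrixP => i j; rewrite [RHS]mxE.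
  apply: homog_degree0_eq0.
    apply: (homog_eq (d := d - d)); last by rewrite subrr.
    rewrite mxE [X in homog_deg _ (_ + X)]mxE; apply: homogB; first exact: (homog_mx_mul hP hQ).
    exact: homog_mx1.
  have : (P *m Q - 1%:M) *m L = 0 by rewrite mulmxBl -mulmxA -DQ -LP mul1mx subrr.
  move/(congr1 (row i)); rewrite row_mul row0 => /kM[v Ev].
  have -> : (P *m Q - 1%:M) i j = (v *m M) 0 j by rewrite -Ev [RHS]mxE.
  rewrite mcoeff0_mulmx big1 // => k _.
  by rewrite [(M k j)@_0%MM](homog_const (hM k j)) ?mulr0 // addrC addKr.
have shd p : sh' p = d.
  apply/eqP; apply: contraT => nd.
  have := QP0 p p; rewrite mxE mcoeffD mcoeff0_mulmx big1 ?add0r => [|k _].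
    by rewrite !mxE eqxx mcoeffN mcoeff1 eqxx => /eqP; rewrite oppr_eq0 oner_eq0.
  by rewrite (homog_const (hQ p k)) ?mul0r // subr_eq0.
have QP : Q *m P = 1%:M.
  apply/eqP; rewrite -subr_eq0; apply/eqP/matrixP => i j; rewrite [RHS]mxE.
  apply: homog_degree0_eq0 (QP0 i j).
  apply: (homog_eq (d := d - d)); last by rewrite subrr.
  rewrite mxE [X in homog_deg _ (_ + X)]mxE; apply: homogB; last exact: homog_mx1.
  by have := homog_mx_mul hQ hP i j; rewrite !shd.
split=> //; exists m1, (M *m P); split.
- exact: homog_mx_mul hM hP.
- exact: linear_quotients_mulr PQ lqM.
move=> u; rewrite DQ mulmxA; split.
  move=> /kM[v Ev]; exists v; rewrite mulmxA -Ev -mulmxA QP mulmx1 //.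
by move=> [v ->]; rewrite mulmxA -[v *m M *m P *m Q]mulmxA PQ mulmx1 kM; exists v.
Qed.

Lemma linear_quotients_resolution m (L : 'M[S]_(m, 1)) d (I : set S) (F : free_seq K s) :
    homog_mx (fun=> d) (fun=> 0) L -> linear_quotients L ->
    (forall f, I f <-> rowspan L (\row__ f)) ->
    minimal_graded_free_resolution F I ->
  forall i (j : 'I_(rk F i)), shift j = d + i%:Z.
Proof.
move=> hL lqL IL [[hA hD] IA [exA exD] minD].
have minv i (v : 'rV[S]_(rk F i.+1)) p : ((v *m dif F i) 0 p)@_0%MM = 0.
  by rewrite mcoeff0_mulmx big1 // => k _; rewrite minD mulr0.
have H0 : (forall j : 'I_(rk F 0), shift j = d) /\
  exists m1 (L1 : 'M[S]_(m1, rk F 0)),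
    [/\ homog_mx (fun=> d + 1) (@shift _ _ F 0) L1, linear_quotients L1 &
        forall u : 'rV_(rk F 0), u *m aug F = 0 <-> rowspan L1 u].
  apply: (linear_quotients_min_cover hL lqL (D := aug F)).
  - by move=> p q; rewrite subr0 ord1; apply: hA.
  - move=> u; have -> : u = \row__ (u 0 0) by apply/rowP => j; rewrite mxE ord1.
    rewrite -IL IA; split=> -[v Ev]; exists v.
      by apply/rowP => j; rewrite mxE Ev ord1.
    by rewrite -Ev mxE.
  - by move=> u /exA[v ->] p.
have Hi i : (forall j : 'I_(rk F i), shift j = d + i%:Z) /\
  exists m1 (L1 : 'M[S]_(m1, rk F i)),
    [/\ homog_mx (fun=> d + i%:Z + 1) (@shift _ _ F i) L1, linear_quotients L1 &
        forall u : 'rV_(rk F i), rowspan L1 u <-> rowspan (dif F i) u].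
  elim: i => [|i [_ [m1 [L1 [hL1 lqL1 spL1]]]]].
    have [E [m1 [L1 [hL1 lqL1 spL1]]]] := H0.
    split=> [j|]; first by rewrite E addr0.
    exists m1, L1; split=> //; first by rewrite addr0.
    by move=> u; rewrite -spL1.
  have [|E [m2 [L2 [hL2 lqL2 spL2]]]] :=
    linear_quotients_min_cover hL1 lqL1 (hD i) spL1.
    by move=> u /exD[v ->] p.
  split=> [j|]; first by rewrite E; lia.
  exists m2, L2; split=> //; last by move=> u; rewrite -spL2.
  by move=> p q; apply: homog_eq (hL2 p q) _; lia.
by move=> i j; have [-> _] := Hi i.
Qed.

End LinearQuotients.

(** * Ideals given by generators *)

Section IdealGen.
Variable A : comNzRingType.
Implicit Types G : set A.

Lemma ideal_gen_mem G g : G g -> ideal_gen G g.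
Proof.
by move=> Gg; exists 1%N, (fun=> 1), (fun=> g); rewrite big_ord1 mul1r.
Qed.

Lemma ideal_gen0 G : ideal_gen G 0.
Proof. by exists 0%N, (fun=> 0), (fun=> 0); rewrite big_ord0; split=> // -[]. Qed.

Lemma ideal_gen_lin G a f g :
  ideal_gen G f -> ideal_gen G g -> ideal_gen G (a * f + g).
Proof.
move=> [m [c [u [Gu ->]]]] [n [d [v [Gv ->]]]]; exists (m + n)%N.
exists (fun i => match split i with inl j => a * c j | inr j => d j end).
exists (fun i => match split i with inl j => u j | inr j => v j end).
split=> [i|]; first by case: (split i).
rewrite big_split_ord mulr_sumr; congr (_ + _); apply: eq_bigr => i _.
  by rewrite (unsplitK (inl i)) mulrA.
by rewrite (unsplitK (inr i)).
Qed.

Lemma ideal_genM G a f : ideal_gen G f -> ideal_gen G (a * f).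
Proof. by rewrite -[a * f]addr0 => H; apply: ideal_gen_lin => //; apply: ideal_gen0. Qed.

Lemma ideal_gen_ind G (P : A -> Prop) f :
    P 0 -> (forall a g h, P g -> P h -> P (a * g + h)) ->
    (forall g, G g -> P g) -> ideal_gen G f -> P f.
Proof.
move=> P0 Plin PG [m [c [g [Gg ->]]]]; apply: big_ind => //.
  by move=> x y Px Py; rewrite -[x]mul1r; apply: Plin.
by move=> i _; rewrite -[_ * _]addr0; apply: Plin => //; apply: PG.
Qed.

Lemma ideal_exp1 G : ideal_exp (ideal_gen G) 1 = ideal_gen G.
Proof.
apply/seteqP; split=> f.
  apply: ideal_gen_ind; [exact: ideal_gen0|exact: ideal_gen_lin|].
  by move=> _ [a [b [Ga _ ->]]]; rewrite mulrC; apply: ideal_genM.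
by move=> Gf; apply: ideal_gen_mem; exists f, 1; rewrite mulr1.
Qed.

Lemma ideal_exp2 G : ideal_exp (ideal_gen G) 2 =
  ideal_gen [set f | exists g h, [/\ G g, G h & f = g * h]].
Proof.
rewrite /ideal_exp iterS -/(ideal_exp (ideal_gen G) 1) ideal_exp1.
apply/seteqP; split=> f.
  apply: ideal_gen_ind; [exact: ideal_gen0|exact: ideal_gen_lin|].
  move=> _ [a [b [Ga Gb ->]]]; move: Ga.
  apply: (ideal_gen_ind (P := fun a => ideal_gen _ (a * b))).
  - by rewrite mul0r; apply: ideal_gen0.
  - by move=> c g h Hg Hh; rewrite mulrDl -mulrA; apply: ideal_gen_lin.
  move=> g Gg; move: Gb.
  apply: (ideal_gen_ind (P := fun b => ideal_gen _ (g * b))).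
  - by rewrite mulr0; apply: ideal_gen0.
  - by move=> c x y Hx Hy; rewrite mulrDr mulrCA; apply: ideal_gen_lin.
  by move=> h Gh; apply: ideal_gen_mem; exists g, h.
apply: ideal_gen_ind; [exact: ideal_gen0|exact: ideal_gen_lin|].
move=> _ [g [h [Gg Gh ->]]]; apply: ideal_gen_mem; exists g, h.
by split=> //; apply: ideal_gen_mem.
Qed.

End IdealGen.

Section HomogIdeal.
Variables (K : fieldType) (s : nat).
Local Notation S := {mpoly K[s]}.

Lemma homog_ideal_resolution (G : set S) e :
  (forall g, G g -> g \is e.-homog) ->
  exists F : free_seq K s, minimal_graded_free_resolution F (ideal_gen G).
Proof.
move=> hG; apply: exists_min_resolution.
  split=> [|a u v Hu Hv]; first by rewrite mxE; apply: ideal_gen0.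
  by rewrite !mxE; apply: ideal_gen_lin.
move=> d f [m [c [g [Gg ->]]]].
rewrite hcomp_sum; exists m, (fun i => hcomp (d - e%:Z) (c i)), g; split=> //.
by apply: eq_bigr => i _; apply: hcompM; apply: (hG _ (Gg i)).
Qed.

Lemma ideal_gen_rowspan (G : set S) m (L : 'M[S]_(m, 1)) :
    (forall f, G f <-> exists t, f = L t 0) ->
  forall f, ideal_gen G f <-> rowspan L (\row__ f).
Proof.
move=> GL f; split.
  apply: (ideal_gen_ind (P := fun f => rowspan L (\row__ f))).
  - by exists 0; rewrite mul0mx; apply/rowP => j; rewrite !mxE.
  - move=> a g h Hg Hh.
    have -> : \row__ (a * g + h) = a *: (\row_(_ < 1) g) + \row__ h.
      by apply/rowP => j; rewrite !mxE.
    exact: rowspan_lin.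
  - move=> _ /GL[t ->]; suff -> : \row__ L t 0 = row t L by apply: rowspan_row.
    by apply/rowP => j; rewrite !mxE ord1.
move=> [v Ev]; have -> : f = \sum_t v 0 t * L t 0.
  by have := congr1 (fun B : 'rV_1 => B 0 0) Ev; rewrite !mxE.
by exists m, (v 0), (fun t => L t 0); split=> // t; apply/GL; exists t.
Qed.

End HomogIdeal.

(** * The deformed square of an ideal of variables *)

Section FourTerms.
Variables (R : comNzRingType) (m : nat) (x y a b : R) (t1 t2 t3 t4 : 'I_m).

(** The shape of the relations of [deformed_syzygy]. *)
Definition comb4 : 'rV[R]_m := x *: delta_mx 0 t1 - y *: delta_mx 0 t2
  - a *: delta_mx 0 t3 + b *: delta_mx 0 t4.

Lemma comb4E j : comb4 0 j = x * (j == t1)%:R - y * (j == t2)%:R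
  - a * (j == t3)%:R + b * (j == t4)%:R.
Proof. by rewrite !mxE. Qed.

Lemma comb4_mulmx (L : 'M[R]_(m, 1)) :
    x * L t1 0 = y * L t2 0 + a * L t3 0 - b * L t4 0 -> comb4 *m L = 0.
Proof.
move=> E; rewrite mulmxDl !mulmxBl -!scalemxAl -!rowE; apply/rowP => k.
rewrite !mxE ord1 E; ring.
Qed.

End FourTerms.

Section DeformedSquare.
Variables (K : fieldType) (s n : nat).
Local Notation S := {mpoly K[s]}.
Variables (Y : 'I_n.+1 -> 'I_s) (YI : injective Y).
Variable z : 'I_n.+1 -> 'I_n.+1 -> S.

Definition deformed (i j : 'I_n.+1) : S :=
  'X_(Y i) * 'X_(Y j) - (if (0 < i < j)%N then 'X_(Y ord0) * z i j else 0).

(** The product of two variables can be regrouped, and the correction terms are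
    multiples of generators Y_0 Y_j and Y_0 Y_l, which come first. This places Y_l
    in the quotient at (i, j) for every l < j. *)
Lemma deformed_syzygy (i j l : 'I_n.+1) : (l < j)%N -> (i <= j)%N ->
  let p := if (l < i)%N then (l, i) else (i, l) in
  'X_(Y l) * deformed i j = 'X_(Y j) * deformed p.1 p.2
    + (if (0 < p.1 < p.2)%N then z p.1 p.2 else 0) * deformed ord0 j
    - (if (0 < i < j)%N then z i j else 0) * deformed ord0 l.
Proof.
move=> lj ij; rewrite /deformed; case: ifP => _ /=; case: ifP => _; case: ifP => _; ring.
Qed.

Definition deformed_idx := [set p : 'I_n.+1 * 'I_n.+1 | (p.1 <= p.2)%N].
Definition deformed_mx : 'M[S]_(#|deformed_idx|, 1) :=
  \matrix_(t, _) deformed (enum_val t).1 (enum_val t).2.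

Lemma deformed_mxP f : (exists i j : 'I_n.+1, (i <= j)%N /\ f = deformed i j) <->
  exists t, f = deformed_mx t 0.
Proof.
split=> [[i [j [ij ->]]]|[t ->]]; last first.
  by have := enum_valP t; rewrite inE mxE => ?; exists (enum_val t).1, (enum_val t).2.
have ijE : (i, j) \in deformed_idx by rewrite inE.
by exists (enum_rank_in ijE (i, j)); rewrite mxE enum_rankK_in.
Qed.

(** It remains to see that a multiplier f of the generator (i, j) is in the ideal of
    the Y_l with l < j. Otherwise f has a monomial m free of these variables. The
    monomial m Y_i Y_j then appears in no multiple of an earlier generator: its
    leading product Y_i' Y_j' does not divide m Y_i Y_j, and the correction terms
    contain Y_0, which is absent from m Y_i Y_j when i > 0. *)
Lemma linear_quotients_deformed : linear_quotients deformed_mx.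
Proof.
pose ev (t : 'I_#|deformed_idx|) := enum_val t.
have evP t : ((ev t).1 <= (ev t).2)%N by have := enum_valP t; rewrite inE.
have L0 t : deformed_mx t 0 = deformed (ev t).1 (ev t).2 by rewrite mxE.
pose o1 (p : 'I_n.+1 * 'I_n.+1) := (p.1 * n.+1 + p.2)%N.
pose o t := o1 (ev t).
have olt (p q : 'I_n.+1 * 'I_n.+1) : (p.1 < q.1)%N -> (o1 p < o1 q)%N.
  move=> lt; rewrite /o1; apply: (@leq_trans (p.1.+1 * n.+1)).
    by rewrite mulSn addnC ltn_add2r.
  by apply: leq_trans (leq_addr _ _); rewrite leq_mul2r lt orbT.
have oP p q : (o1 p < o1 q)%N -> (p.1 < q.1)%N \/ p.1 = q.1 /\ (p.2 < q.2)%N.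
  move=> lt; case: (ltngtP p.1 q.1) => [|/olt|E].
  - by left.
  - by move=> lt'; have := ltn_trans lt lt'; rewrite ltnn.
  - by right; split; [apply: val_inj|move: lt; rewrite /o1 E ltn_add2l].
have oI : injective o.
  move=> t t' E1; apply: enum_val_inj.
  have o12 : (ev t).1 = (ev t').1.
    apply: val_inj; case: (ltngtP (ev t).1 (ev t').1) => // /olt.
      by rewrite -/(o t) -/(o t') E1 ltnn.
    by rewrite -/(o t) -/(o t') E1 ltnn.
  apply/eqP; rewrite -pair_eqE /pair_eq /=; apply/andP; split; first by apply/eqP.
  by move/eqP: E1; rewrite /o /o1 o12 eqn_add2l.
exists o, (fun t => [set Y l | l : 'I_n.+1 & (l < (ev t).2)%N]); split=> // t f.
split.
  move=> [c [cL ct cz]] m fm; apply: contrapT => nA.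
  have mz (l : 'I_n.+1) : (l < (ev t).2)%N -> m (Y l) = 0%N.
    move=> lt; apply/eqP; apply: contrapT => /negP ml.
    by apply: nA; exists (Y l) => //; apply: imset_f; rewrite inE.
  pose mm := (U_(Y (ev t).1) + U_(Y (ev t).2) + m)%MM.
  have mm0 : (0 < (ev t).1)%N -> mm (Y ord0) = 0%N.
    move=> i0; have j0 := leq_trans i0 (evP t).
    by rewrite !mnmDE !mnm1E !(inj_eq YI) -!val_eqE /= !gtn_eqF // mz.
  have xz (i j : 'I_n.+1) h : (i <= (ev t).1)%N ->
      (h * (if (0 < i < j)%N then 'X_(Y ord0) * z i j else 0))@_mm = 0.
    move=> ii; case: ifP => [/andP[i0 _]|_]; last by rewrite mulr0 mcoeff0.
    by rewrite mulrCA mcoeff_mulXU mm0 // (leq_trans i0).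
  have := congr1 (fun B : 'rV_1 => (B 0 0)@_mm) cL.
  rewrite /= !mxE mcoeff0 raddf_sum (bigD1 t) //= big1 ?addr0.
    rewrite ct L0 mulrBr mcoeffB xz // subr0 -mpolyXD mulrC.
    by rewrite mcoeff_mulXm lem_addr /mm addmC addmK => E1; rewrite E1 eqxx in fm.
  move=> t' tt'.
  have [lt|le] := ltnP (o t) (o t'); first by rewrite cz // mul0r mcoeff0.
  have lt' : (o t' < o t)%N.
    by rewrite ltn_neqAle le andbT; apply: contra_neq tt' => /oI.
  have H := oP _ _ lt'.
  have i'i : ((ev t').1 <= (ev t).1)%N by case: H => [/ltnW//|[-> _]].
  rewrite L0 mulrBr mcoeffB xz // subr0 -mpolyXD mulrC mcoeff_mulXm.
  case: ifP => // /mnm_lepP le'; exfalso; case: H => [i'lt|[E1 j'lt]].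
    have := le' (Y (ev t').1); rewrite !mnmDE !mnm1E !(inj_eq YI) eqxx mz; last first.
      exact: leq_trans i'lt (evP t).
    by rewrite -!val_eqE /= (gtn_eqF i'lt) (gtn_eqF (leq_trans i'lt (evP t))).
  have := le' (Y (ev t').2); rewrite !mnmDE !mnm1E !(inj_eq YI) eqxx mz // E1.
  by rewrite -[(ev t).2 == _]val_eqE /= (gtn_eqF j'lt) !addn0 addn1 ltnn.
apply: (var_ideal_ind (P := fun f => exists c : 'rV_#|deformed_idx|,
  [/\ c *m deformed_mx = 0, c 0 t = f & forall j, (o t < o j)%N -> c 0 j = 0])).
- by exists 0; split; rewrite ?mul0mx ?mxE // => j _; rewrite mxE.
- move=> a g h [v [vM vg vz]] [w [wM wh wz]]; exists (a *: v + w); split.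
  + by rewrite mulmxDl -scalemxAl vM wM scaler0 addr0.
  + by rewrite !mxE vg wh.
  + by move=> j lt; rewrite !mxE vz ?wz // mulr0 addr0.
move=> a0 /imsetP[l]; rewrite inE => lj ->.
have idxP (i j : 'I_n.+1) : (i <= j)%N -> exists t', ev t' = (i, j).
  move=> ij; have ijE : (i, j) \in deformed_idx by rewrite inE.
  by exists (enum_rank_in ijE (i, j)); rewrite /ev enum_rankK_in.
have := deformed_syzygy lj (evP t); cbv zeta; set p := (if _ then _ else _) => E.
have [tp etp] : exists t', ev t' = p.
  by rewrite /p; case: ltnP => H; apply: idxP; rewrite ?(ltnW H).
have [tj etj] := idxP ord0 (ev t).2 isT.
have [tl etl] := idxP ord0 l isT.
set a := (if (0 < p.1 < p.2)%N then z p.1 p.2 else 0) in E.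
set b := (if (0 < _ < _)%N then _ else 0) in E.
have op : (o tp < o t)%N.
  rewrite /o etp /p; case: (ltnP l (ev t).1) => H; first exact: olt.
  by rewrite /o1 /= ltn_add2l.
have oa : a = 0 \/ (o tj < o t)%N.
  rewrite /a /p; case: ifP => [/andP[p0 _]|]; last by left.
  right; rewrite /o etj; apply: olt => /=; move: p0; case: ifP => //= + _.
  by move=> /(leq_ltn_trans _) ->.
have ob : b = 0 \/ (o tl < o t)%N.
  rewrite /b; case: ifP => [/andP[p0 _]|]; last by left.
  by right; rewrite /o etl; apply: olt.
have dz (x : S) (t1 t2 : 'I_#|deformed_idx|) : x = 0 \/ (o t1 < o t)%N -> (o t <= o t2)%N ->
    x * (t2 == t1)%:R = 0.
  move=> [->|lt] le; first by rewrite mul0r.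
  case: (eqVneq t2 t1) => [E1|_]; last by rewrite mulr0.
  by rewrite E1 leqNgt lt in le.
exists (comb4 'X_(Y l) 'X_(Y (ev t).2) a b t tp tj tl); split.
- by apply: comb4_mulmx; rewrite !L0 etp etj etl.
- rewrite comb4E eqxx mulr1 (dz _ tp t) ?(dz _ tj t) ?(dz _ tl t) //; last by right.
  by rewrite !subr0 addr0.
move=> j lt; rewrite comb4E (dz _ tp j) ?(dz _ tj j) ?(dz _ tl j) ?(ltnW lt) //.
  have /negPf -> : j != t by apply: contraTneq lt => ->; rewrite ltnn.
  by rewrite mulr0 !subr0 addr0.
by right.
Qed.

End DeformedSquare.

(** * The regularity of the ideal *)

Section Supremum.
Implicit Types A : set (\bar int).

Lemma supremum_singleton A (x y : \bar int) :
  A x -> (forall r, A r -> r = x) -> supremum y A = x.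
Proof.
move=> Ax Ae; suff -> : A = [set x]%classic by rewrite supremum1.
by apply/seteqP; split=> r /=; [exact: Ae|move=> ->].
Qed.

(** The extended integers are complete: the nonempty sets without a greatest element
    are unbounded, with supremum +oo. *)
Lemma supremum_ge A (x y : \bar int) : A x -> (x <= supremum y A)%E.
Proof.
move=> Ax; apply: ge_supremum_Nmem => //.
have [Ay|nAy] := pselect (A +oo%E).
  by exists +oo%E; split=> [r _|r]; [rewrite leey|exact].
have [[b Hb]|nb] := pselect (exists b : int, ubound A b%:E); last first.
  exists +oo%E; split=> [r _|r Hr]; first by rewrite leey.
  case: r Hr => [b Hb||Hr]; last 1 first.
  - have := Hr _ Ax; rewrite leeNy_eq => /eqP xE.
    by case: nb; exists 0; move=> t /Hr; rewrite leeNy_eq => /eqP ->; rewrite leNye.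
  - by case: nb; exists b.
  - by rewrite lexx.
have [[a Aa]|nA] := pselect (exists a : int, A a%:E); last first.
  have xE t : A t -> t = -oo%E.
    by case: t => // a Aa; case: nA; exists a.
  exists -oo%E; split=> [t /xE ->|t _]; rewrite ?lexx ?leNye //.
pose P k := `[< A (b - (k%:Z))%:E >].
have exP : exists k, P k.
  exists `|b - a|%N; apply/asboolP.
  have := Hb _ Aa; rewrite lee_fin => ab.
  by rewrite gez0_abs ?subr_ge0 // opprB addrCA subrr addr0.
have [k /asboolP Ak mink] := ex_minnP exP.
exists (b - k%:Z)%:E; split=> [[c| |]|t Ht]; last exact: Ht.
- move=> Ac; have := Hb _ Ac; rewrite !lee_fin => cb.
  have : P `|b - c|%N.
    by apply/asboolP; rewrite gez0_abs ?subr_ge0 // opprB addrCA subrr addr0.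
  by move/mink; lia.
- by move/nAy.
- by rewrite leNye.
Qed.

End Supremum.

Section IdealIn.
Variables (K : fieldType) (n : nat).

Lemma nvars_gt : (n < nvars n)%N.
Proof.
rewrite /nvars ltnS leq_divRL //; case: n => // k.
by rewrite leq_mul2l.
Qed.

Definition yidx (k : 'I_n.+1) : 'I_(nvars n) := inord k.
Definition zvar (i j : 'I_n.+1) : {mpoly K[nvars n]} :=
  xvar K n (tidx n i.+1 j.+1).

Lemma yidxE k : yidx k = k :> nat.
Proof. by rewrite inordK //; apply: leq_trans (ltn_ord k) nvars_gt. Qed.

Lemma yidx_inj : injective yidx.
Proof. by move=> i j E; apply: val_inj; rewrite /= -!yidxE E. Qed.

Lemma idealI_gensP f : idealI_gens K n f <->
  exists i j : 'I_n.+1, (i <= j)%N /\ f = deformed yidx zvar i j.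
Proof.
split.
  case=> [[[i /andP[i1 iN] ->]|[i /andP[i1 iN] ->]]|[i [j [i1 ij jN ->]]]].
  - have iN' : (i.-1 < n.+1)%N by rewrite -ltnS prednK.
    exists (Ordinal iN'), (Ordinal iN'); split=> //.
    by rewrite /deformed ltnn andbF subr0 expr2.
  - have iN' : (i.-1 < n.+1)%N by lia.
    exists ord0, (Ordinal iN'); split=> //.
    by rewrite /deformed subr0.
  - have iN' : (i.-1 < n.+1)%N by lia.
    have jN' : (j.-1 < n.+1)%N by lia.
    exists (Ordinal iN'), (Ordinal jN'); split=> /=; first lia.
    rewrite /deformed /zvar /=; have -> : (0 < i.-1 < j.-1)%N by lia.
    by rewrite !prednK //; lia.
move=> [i [j [ij ->]]]; rewrite /deformed.
have [ij'|ji] := ltnP i j; last first.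
  have -> : j = i by apply: val_inj; apply/eqP; rewrite eqn_leq ji ij.
  left; left; exists i.+1; first by rewrite /= ltn_ord.
  by rewrite andbF subr0.
have [i0|i0] := posnP i.
  left; right; exists j.+1; first by rewrite ltn_ord andbT; lia.
  by rewrite subr0; congr (_ * _); rewrite /xvar /= /yidx i0.
right; exists i.+1, j.+1; split; rewrite ?ltn_ord //.
Qed.

Lemma idealI_gens_homog f : idealI_gens K n f -> f \is 2.-homog.
Proof.
move=> /idealI_gensP[i [j [_ ->]]]; rewrite /deformed; apply: rpredB.
  by rewrite -mpolyXD dhomogX /= mdegD !mdeg1.
case: ifP => _; last exact: dhomog0.
by rewrite /zvar /xvar -mpolyXD dhomogX /= mdegD !mdeg1.
Qed.

Lemma idealI_resolution_shift (F : free_seq K (nvars n)) i (j : 'I_(rk F i)) :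
  minimal_graded_free_resolution F (idealI K n) -> shift j = 2 + i%:Z.
Proof.
move=> HF; apply: (linear_quotients_resolution (L := deformed_mx yidx zvar) (d := 2%R) _ _ _ HF).
- move=> p q; rewrite subr0 mxE; apply: (idealI_gens_homog _).
  by apply/idealI_gensP/deformed_mxP; exists p; rewrite mxE.
- exact/linear_quotients_deformed/yidx_inj.
- by apply: ideal_gen_rowspan => f; rewrite idealI_gensP; apply: deformed_mxP.
Qed.

Lemma reg_idealI : reg (idealI K n) = 2%:E.
Proof.
have [F HF] := homog_ideal_resolution idealI_gens_homog.
have I0 : idealI K n ('X_(yidx ord0) ^+ 2).
  apply: ideal_gen_mem; apply/idealI_gensP; exists ord0, ord0; split=> //.
  by rewrite /deformed subr0 expr2.
apply: supremum_singleton; last first.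
  by move=> _ [G [i [j [HG ->]]]]; rewrite (idealI_resolution_shift _ HG) addrK.
case E : (rk F 0) => [|r].
  have [_ /(_ ('X_(yidx ord0) ^+ 2)) [/(_ I0)[u Eu] _] _ _] := HF.
  move: Eu; rewrite mxE big1 => [/eqP|k _]; last by have := ltn_ord k; rewrite {2}E.
  rewrite expf_eq0 /= => /eqP /(congr1 (mcoeff U_(yidx ord0)%MM)).
  by rewrite mcoeffX eqxx mcoeff0 => /eqP; rewrite oner_eq0.
have r0 : (0 < rk F 0)%N by rewrite E.
exists F, 0%N, (Ordinal r0); split=> //.
by rewrite (idealI_resolution_shift _ HF) subr0 addr0.
Qed.

End IdealIn.

Lemma nvars_inj : injective nvars.
Proof.
have lt i j : (i < j)%N -> (nvars i < nvars j)%N.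
  move=> ij; rewrite /nvars ltnS; apply: (@leq_trans ((1 * 2 + i * i.+1) %/ 2)).
    by rewrite divnMDl.
  by apply: leq_div2r; nia.
by move=> i j E; case: (ltngtP i j) => // /lt; rewrite E ltnn.
Qed.

Lemma infinite_family (T : nat -> Type) (I : forall n, T (nvars n)) :
  ~ cardinality.finite_set
     [set existT T (nvars n) (I n) | n in [set n : nat | (3 <= n)%N]]%classic.
Proof.
rewrite (cardinality.eq_finite_set (cardinality.inj_card_eq _)); last first.
  by move=> i j _ _ /(congr1 (@projT1 _ _)); apply: nvars_inj.
move=> /(cardinality.finite_image (subn^~ 3)) fin.
apply: cardinality.infinite_nat; move: fin.
apply: cardinality.sub_finite_set => k _; exists (k + 3)%N; last exact: addnK.
exact: leq_addl.
Qed.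

(** * A chase through the Koszul complex *)

Section Koszul.
Variables (K : fieldType) (s : nat).
Hypothesis charK : [pchar K] =i pred0.
Local Notation S := {mpoly K[s]}.
Implicit Types (p q : S) (l : 'I_s).

Let natK k : (k.+1%:R : K) != 0.
Proof. by have /pcharf0P -> := charK. Qed.

(** Euler's formula for the sum of the x_i d/dx_i shows that the derivations, divided
    by degrees, contract the Koszul complex. Dividing each monomial by its own
    degree plus k avoids a restriction to homogeneous elements. *)
Definition euler_scale k p : S := scale_coef (fun m => (mdeg m + k)%:R^-1) p.

Lemma euler_scale_mulX k i p : euler_scale k ('X_i * p) = 'X_i * euler_scale k.+1 p.
Proof.
rewrite /euler_scale scale_coef_mulXm; congr (_ * _); apply: eq_scale_coef => m.
by rewrite mdegD mdeg1; congr (_%:R^-1); lia.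
Qed.

Lemma euler_scale0 k : euler_scale k 0 = 0.
Proof. by rewrite -[0 : S](scale0r 0) /euler_scale scale_coefZ !scale0r. Qed.

Lemma euler_scaleN k p : euler_scale k (- p) = - euler_scale k p.
Proof. by rewrite -scaleN1r /euler_scale scale_coefZ scaleN1r. Qed.

Lemma euler_scale_sum k (F : 'I_s -> S) :
  \sum_i 'X_i * euler_scale k.+1 (F i) = euler_scale k (\sum_i 'X_i * F i).
Proof. by rewrite /euler_scale scale_coef_sum; apply: eq_bigr => i _; rewrite -euler_scale_mulX. Qed.

Lemma euler_formula p :
  \sum_(i < s) 'X_i * p^`M(i) = scale_coef (fun m => (mdeg m)%:R) p.
Proof.
apply/mpolyP => m; rewrite mcoeff_scale_coef raddf_sum /= mdegE natr_sum mulr_suml.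
apply: eq_bigr => i _; rewrite mcoeff_mulXU; case: eqP => [->|/eqP mi].
  by rewrite mul0r.
rewrite mcoeff_deriv mnmBE mnm1E eqxx subn1 prednK ?lt0n // mulr_natl.
by rewrite submK // lep1mP.
Qed.

Lemma euler_scaleK k p : euler_scale k.+1 (\sum_(i < s) 'X_i * p^`M(i) + k.+1%:R *: p) = p.
Proof.
rewrite euler_formula; apply/mpolyP => m.
rewrite mcoeff_scale_coef mcoeffD mcoeffZ mcoeff_scale_coef -mulrDl -natrD mulKf //.
by rewrite addnS.
Qed.

Lemma euler_scale0K p : p@_0%MM = 0 -> euler_scale 0 (\sum_(i < s) 'X_i * p^`M(i)) = p.
Proof.
move=> p0; rewrite euler_formula; apply/mpolyP => m; rewrite !mcoeff_scale_coef addn0.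
have [->|m0] := eqVneq m 0%MM; first by rewrite p0 !mulr0.
by rewrite mulKf //; move: m0; rewrite -mdeg_eq0; case: (mdeg m).
Qed.

Lemma sum_mulX_deriv l (F : 'I_s -> S) :
  \sum_i 'X_i * F i = 0 -> \sum_i 'X_i * (F i)^`M(l) = - F l.
Proof.
move/(congr1 (mderiv l)); rewrite mderiv0 raddf_sum /=.
under eq_bigr do rewrite mderivM.
rewrite big_split /= (bigD1 l) //= big1 ?addr0 => [|i il].
  rewrite mderivX mnm1E eqxx scale1r.
  have -> : (U_(l) - U_(l) = 0 :> 'X_{1..s})%MM.
    by apply/mnmP => i; rewrite mnmBE subnn mnm0E.
  by rewrite mpolyX0 mul1r => /eqP; rewrite addrC addr_eq0 => /eqP.
by rewrite mderivX mnm1E (negPf il) scale0r mul0r.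
Qed.

(** The contracting homotopy in degree 1 of the Koszul complex, and in degree 2
    below. *)
Definition koszul1 (v : 'I_s -> S) l m := euler_scale 2 ((v l)^`M(m) - (v m)^`M(l)).

Lemma koszul1N v l m : koszul1 v l m = - koszul1 v m l.
Proof. by rewrite -euler_scaleN opprB. Qed.

Lemma koszul1P v l :
  \sum_i 'X_i * v i = 0 -> \sum_m 'X_m * koszul1 v l m = v l.
Proof.
move=> H; rewrite euler_scale_sum -[RHS](euler_scaleK 0); congr euler_scale.
under eq_bigr do rewrite mulrBr.
by rewrite sumrB [X in _ - X](sum_mulX_deriv l H) opprK scale1r.
Qed.

Definition koszul2 (u : 'I_s -> 'I_s -> S) l m h :=
  euler_scale 3 ((u l m)^`M(h) + (u m h)^`M(l) + (u h l)^`M(m)).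

Lemma koszul2_cyclic u l m h : koszul2 u l m h = koszul2 u m h l.
Proof. by rewrite /koszul2 -addrA addrC. Qed.

Lemma koszul2_diag u l m : (forall l m, u l m = - u m l) ->
  (forall l, u l l = 0) -> koszul2 u l m m = 0.
Proof.
by move=> uN u0; rewrite /koszul2 u0 mderiv0 addr0 uN mderivN addNr euler_scale0.
Qed.

Lemma koszul2P u l m : (forall l m, u l m = - u m l) ->
  (forall l, \sum_m 'X_m * u l m = 0) ->
  \sum_h 'X_h * koszul2 u l m h = u l m.
Proof.
move=> uN uz; rewrite euler_scale_sum -[RHS](euler_scaleK 1); congr euler_scale.
have E1 := sum_mulX_deriv l (uz m).
have E2 := sum_mulX_deriv m (uz l).
under eq_bigr do rewrite 2!mulrDr (uN _ l) mderivN mulrN.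
rewrite sumrB big_split /= [X in _ + X - _]E1 [X in _ - X]E2 opprK -addrA.
by congr (_ + _); rewrite -uN scaler_nat mulr2n.
Qed.

(** The coefficients of the exterior product of the basis vectors a and b. *)
Definition alt2 (a b l m : 'I_s) : S :=
  ((l == a) && (m == b))%:R - ((l == b) && (m == a))%:R.

Lemma alt2N a b l m : alt2 a b l m = - alt2 a b m l.
Proof. by rewrite /alt2 opprB; congr (_%:R - _%:R); rewrite andbC. Qed.

Lemma alt2_diag a b l : alt2 a b l l = 0.
Proof. by rewrite /alt2 andbC subrr. Qed.

Lemma alt2_mul a b l : \sum_m 'X_m * alt2 a b l m =
  (l == a)%:R * 'X_b - (l == b)%:R * 'X_a.
Proof.
rewrite /alt2; under eq_bigr do rewrite mulrBr.
rewrite sumrB (bigD1 b) //= big1 => [|m /negPf ->]; last by rewrite andbF mulr0.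
rewrite (bigD1 a) //= big1 => [|m /negPf ->]; last by rewrite andbF mulr0.
by rewrite !eqxx !andbT !addr0 ![_%:R * _]mulrC.
Qed.

Lemma homog_vecZ r (sh : 'I_r -> int) d e p (v : 'rV[S]_r) :
  homog_deg e p -> homog_vec sh d v -> homog_vec sh (d + e) (p *: v).
Proof.
move=> hp hv q; rewrite mxE; apply: homog_eq (homogM hp (hv q)) _; lia.
Qed.

Lemma homog_vecD r (sh : 'I_r -> int) d (v w : 'rV[S]_r) :
  homog_vec sh d v -> homog_vec sh d w -> homog_vec sh d (v + w).
Proof. by move=> hv hw q; rewrite mxE; apply: homogD. Qed.

Lemma homog_vec_sum r (sh : 'I_r -> int) d (F : 'I_s -> 'rV[S]_r) :
  (forall i, homog_vec sh d (F i)) -> homog_vec sh d (\sum_i F i).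
Proof.
move=> H; apply: big_ind => //; last by move=> *; apply: homog_vecD.
by move=> q; rewrite mxE; apply: homog0.
Qed.

Lemma vsumE r (F : 'I_s -> 'rV[S]_r) j :
  (\sum_i 'X_i *: F i) 0 j = \sum_i 'X_i * F i 0 j.
Proof. by rewrite summxE; apply: eq_bigr => i _; rewrite mxE. Qed.

Lemma vsum_mulmx r r' (F : 'I_s -> 'rV[S]_r) (M : 'M[S]_(r, r')) :
  (\sum_i 'X_i *: F i) *m M = \sum_i 'X_i *: (F i *m M).
Proof. by rewrite mulmx_suml; apply: eq_bigr => i _; rewrite scalemxAl. Qed.

Lemma alt_sum0 r (u : 'I_s -> 'I_s -> 'rV[S]_r) : (forall l m, u l m = - u m l) ->
  \sum_l 'X_l *: \sum_m 'X_m *: u l m = 0.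
Proof.
move=> uN; set T := LHS.
have TN : T = - T.
  rewrite {1}/T; under eq_bigr do rewrite scaler_sumr.
  rewrite exchange_big -sumrN; apply: eq_bigr => l _ /=.
  rewrite scaler_sumr -sumrN; apply: eq_bigr => m _.
  by rewrite (uN m l) !scalerN !scalerA mulrC.
apply/rowP => j; rewrite [RHS]mxE; apply/mpolyP => m; rewrite mcoeff0.
have := congr1 (fun B : 'rV_r => (B 0 j)@_m) TN; rewrite /= [(- T) 0 j]mxE mcoeffN.
move/eqP; rewrite -addr_eq0 -mulr2n -mulr_natl mulf_eq0 (negPf (natK 1)) /=.
by move/eqP.
Qed.

(** The left-hand side in the conclusion is the Koszul boundary of f times the exterior
    product of the basis vectors a, b, c. Lift it to a chain u over F_0. Its
    boundary v' is v times the first differential, and the boundary y of v is w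
    times the second one. Since no generator of F_2 has the degree d + 3 of
    w, the coordinates of w have no constant terms and w is itself a Koszul
    boundary. Correcting v, and then u, by this yields cycles over free modules,
    which are boundaries; R is the image in J of the chain that bounds u. *)
Lemma koszul_chase (F : free_seq K s) (J : set S) (f : S) d (a b c : 'I_s) :
    minimal_graded_free_resolution F J -> homog_deg d f ->
    J ('X_a * f) -> J ('X_b * f) -> J ('X_c * f) ->
    (forall j : 'I_(rk F 2), shift j != d + 3) ->
  exists R : 'I_s -> 'I_s -> 'I_s -> S,
    [/\ forall l m h, J (R l m h), forall l m h, R l m h = R m h l,
        forall l m, R l m m = 0 &
        forall l m, (alt2 a b l m * 'X_c + alt2 b c l m * 'X_a
                     + alt2 c a l m * 'X_b) * f = \sum_h 'X_h * R l m h].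
Proof.
move=> [[hA hD] IA [exA exD] minD] hf Ja Jb Jc nsh.
have hA' : homog_mx (@shift _ _ F 0) (fun=> 0) (aug F).
  by move=> p q; rewrite subr0 ord1; apply: hA.
have lift0 (x : 'I_s) : J ('X_x * f) -> exists2 k : 'rV_(rk F 0),
    homog_vec (@shift _ _ F 0) (d + 1) k & k *m aug F = \row__ ('X_x * f).
  move=> /IA[u Eu].
  have E : \row_(_ < 1) ('X_x * f) = u *m aug F.
    by apply/rowP => j; rewrite mxE Eu ord1.
  have [|k hk Ek] := lift_homog (d := d + 1) hA' _ E; last by exists k.
  move=> q; rewrite mxE subr0 addrC; have := homogX K U_(x)%MM.
  by rewrite mdeg1 => hx; apply: homogM hx hf.
have [ka hka Eka] := lift0 _ Ja.
have [kb hkb Ekb] := lift0 _ Jb.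
have [kc hkc Ekc] := lift0 _ Jc.
have hX (i : 'I_s) : homog_deg 1%R ('X_i : S).
  by have := homogX K U_(i)%MM; rewrite mdeg1.
pose u l m : 'rV[S]_(rk F 0) := alt2 a b l m *: kc + alt2 b c l m *: ka + alt2 c a l m *: kb.
have uN l m : u l m = - u m l.
  by rewrite /u (alt2N a) (alt2N b) (alt2N c) !scaleNr -!opprD.
have u0 l : u l l = 0 by rewrite /u !alt2_diag !scale0r !addr0.
have uaug l m : (u l m *m aug F) 0 0 = (alt2 a b l m * 'X_c + alt2 b c l m * 'X_a
                     + alt2 c a l m * 'X_b) * f.
  by rewrite !mulmxDl -!scalemxAl Eka Ekb Ekc !mxE; ring.
pose v' l := \sum_m 'X_m *: u l m.
have halt x y l m : homog_deg 0%R (alt2 x y l m).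
  by apply: (homogB (d := 0%R)); case: andP => _; [exact: dhomog1|exact: dhomog0|exact: dhomog1|exact: dhomog0].
have hu l m : homog_vec (@shift _ _ F 0) (d + 1) (u l m).
  by do 2?[apply: homog_vecD]; rewrite -[d + 1]addr0; apply: homog_vecZ.
have hv' l : homog_vec (@shift _ _ F 0) (d + 2) (v' l).
  apply: homog_vec_sum => m; have -> : d + 2 = d + 1 + 1 by lia.
  exact: homog_vecZ (hX m) (hu l m).
have v'aug l : v' l *m aug F = 0.
  rewrite vsum_mulmx; apply/rowP => j; rewrite ord1 vsumE [RHS]mxE.
  under eq_bigr do rewrite uaug mulrA 2!mulrDr 2!mulrDl !mulrA.
  rewrite !big_split -!mulr_suml !alt2_mul /=; ring.
have /fin_all_exists2[v hv Ev] : forall l, exists2 x : 'rV_(rk F 1),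
    homog_vec (@shift _ _ F 1) (d + 2) x & v' l = x *m dif F 0.
  by move=> l; have /exA[x Ex] := v'aug l; apply: lift_homog (hD 0%N) (hv' l) Ex.
pose y := \sum_l 'X_l *: v l.
have hy : homog_vec (@shift _ _ F 1) (d + 3) y.
  apply: homog_vec_sum => l; have -> : d + 3 = d + 2 + 1 by lia.
  exact: homog_vecZ (hX l) (hv l).
have yD : y *m dif F 0 = 0.
  by rewrite vsum_mulmx -[RHS](alt_sum0 uN); apply: eq_bigr => l _; rewrite -Ev.
have /exD[w0 Ew0] := yD.
have [w hw Ew] := lift_homog (hD 1%N) hy Ew0.
have wc j : (w 0 j)@_0%MM = 0.
  by apply: homog_const (hw j) _; rewrite subr_eq0 eq_sym nsh.
pose wl l : 'rV[S]_(rk F 2) := \row_j euler_scale 1 (w 0 j)^`M(l).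
have Ewl : w = \sum_l 'X_l *: wl l.
  apply/rowP => j; rewrite vsumE; under eq_bigr do rewrite mxE.
  by rewrite euler_scale_sum euler_scale0K.
pose v2 l := v l - wl l *m dif F 1.
have v2z : \sum_l 'X_l *: v2 l = 0.
  under eq_bigr do rewrite scalerBr.
  by rewrite sumrB -vsum_mulmx -Ewl -Ew subrr.
pose t l m : 'rV[S]_(rk F 1) := \row_j koszul1 (fun i => v2 i 0 j) l m.
have Et l : \sum_m 'X_m *: t l m = v2 l.
  apply/rowP => j; rewrite vsumE; under eq_bigr do rewrite mxE.
  by rewrite koszul1P // -vsumE v2z mxE.
have tN l m : t l m = - t m l by apply/rowP => j; rewrite !mxE koszul1N.
have t0 l : t l l = 0 by apply/rowP => j; rewrite !mxE /koszul1 subrr euler_scale0.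
pose u2 l m := u l m - t l m *m dif F 0.
have u2N l m : u2 l m = - u2 m l by rewrite /u2 uN tN mulNmx opprB opprK addrC.
have u20 l : u2 l l = 0 by rewrite /u2 u0 t0 mul0mx subrr.
have DD (x : 'rV_(rk F 2)) : x *m dif F 1 *m dif F 0 = 0 by apply/exD; exists x.
have DA (x : 'rV_(rk F 1)) : x *m dif F 0 *m aug F = 0 by apply/exA; exists x.
have u2z l : \sum_m 'X_m *: u2 l m = 0.
  under eq_bigr do rewrite scalerBr.
  by rewrite sumrB -vsum_mulmx Et mulmxBl DD subr0 -Ev subrr.
pose r l m h : 'rV[S]_(rk F 0) := \row_j koszul2 (fun i i' => u2 i i' 0 j) l m h.
have r_u l m : \sum_h 'X_h *: r l m h = u2 l m.
  apply/rowP => j; rewrite vsumE; under eq_bigr do rewrite mxE.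
  rewrite koszul2P // => [i i'|i]; first by rewrite u2N mxE.
  by rewrite -vsumE u2z mxE.
exists (fun l m h => (r l m h *m aug F) 0 0); split.
- by move=> l m h; apply/IA; exists (r l m h).
- move=> l m h; suff -> : r l m h = r m h l by [].
  apply/rowP => j.
  rewrite [LHS]mxE [RHS]mxE.
  exact: koszul2_cyclic.
- move=> l m; suff -> : r l m m = 0 by rewrite mul0mx mxE.
  apply/rowP => j; rewrite !mxE koszul2_diag // => [i i'|i].
    by rewrite u2N mxE.
  by rewrite u20 mxE.
move=> l m; rewrite -uaug -vsumE -vsum_mulmx r_u.
by rewrite mulmxBl DA subr0.
Qed.

End Koszul.

(** * Positions of the variables z_ij *)

Section Indices.
Variable n : nat.

Lemma half_consec k : ((k * (k - 1)) %/ 2 * 2 = k * (k - 1))%N.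
Proof.
apply: divnK; rewrite dvdn2 oddM; case: k => // k.
by rewrite subSS subn0 /= andNb.
Qed.

(** The index of z_ij among the variables numbered from 0, where y_i has index i. *)
Definition zpos i j := (tidx n i.+1 j.+1).-1.

Lemma zposE i j : zpos i j = (i * n - (i * (i - 1)) %/ 2 + (j - i))%N.
Proof. by rewrite /zpos /tidx /= subSS -[2%N]/(1.+1) subSS addn1 addSn. Qed.

Lemma nvarsE : ((nvars n).-1 * 2 = n * n.+1)%N.
Proof. by have := half_consec n.+1; rewrite subSS subn0 (mulnC n.+1) /nvars. Qed.

Lemma zpos_lt i j : (0 < i)%N -> (i < j)%N -> (j <= n)%N -> (zpos i j < nvars n)%N.
Proof.
move=> i0 ij jn; rewrite zposE.
have := half_consec i; have := nvarsE; move: (_ %/ _)%N => q.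
rewrite /nvars /=; move: (_ %/ _)%N => p Hp Hq.
have [k En] : exists k, n = (i + k.+1)%N by exists (n - i.+1)%N; lia.
have [i' Ei] : exists i', i = i'.+1 by exists i.-1; lia.
subst i; rewrite subn1 /= in Hq *.
nia.
Qed.

Lemma zpos_ge i j : (2 < n)%N -> (0 < i)%N -> (i < j)%N -> (3 < j)%N -> (j <= n)%N ->
  [/\ (3 < zpos i j)%N, zpos i j != n.+1, zpos i j != n.+2 & zpos i j != n.*2].
Proof.
move=> n2 i0 ij j3 jn; rewrite zposE.
have := half_consec i; move: (_ %/ _)%N => q Hq.
have [i2|i2] := leqP i 2.
  by move: i2 i0 Hq; case: i ij => [|[|[|]]] //= *; split; lia.
have [i' Ei] : exists i', i = (i' + 3)%N by exists (i - 3)%N; lia.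
have [k En] : exists k, n = (i + k.+1)%N by exists (n - i.+1)%N; lia.
suff : (n.*2 < i * n - q + (j - i))%N by split; lia.
have Ei1 : (i - 1 = i' + 2)%N by lia.
rewrite Ei1 in Hq.
subst i; nia.
Qed.

Lemma zpos12 : zpos 1 2 = n.+1.
Proof. by rewrite zposE; lia. Qed.
Lemma zpos13 : zpos 1 3 = n.+2.
Proof. by rewrite zposE; lia. Qed.
Lemma zpos23 : (0 < n)%N -> zpos 2 3 = n.*2.
Proof. by rewrite zposE -[((2 * _) %/ 2)%N]/1%N => n0; lia. Qed.

End Indices.

(** * The square of the ideal *)

Section Toric.
Variables (K : fieldType) (n : nat).
Hypothesis n2 : (2 < n)%N.
Local Notation S := {mpoly K[nvars n]}.

(** The exponents realise t = X^40, u_1 = X, u_2 = X^3, u_3 = X^9 in the substitution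
    x = t, y_i = t u_i, z_ij = t u_i u_j. Every variable goes to 0 or to a multiple of
    t, and the exponents that come from products of the u_i stay below 40 in the
    coefficients that are compared, so the exponent determines the degree in t. *)
Definition toric_wt (i : nat) : option nat :=
  if i == 0%N then Some 40 else if i == 1%N then Some 41
  else if i == 2 then Some 43 else if i == 3 then Some 49
  else if i == n.+1 then Some 44 else if i == n.+2 then Some 50
  else if i == n.*2 then Some 52 else None.

Definition toric_var (i : nat) : {poly K} :=
  if toric_wt i is Some e then 'X^e else 0.

Definition toric (p : S) : {poly K} := mmap polyC (fun i => toric_var i) p.

Lemma toric_is_additive : additive toric. Proof. exact: raddfB. Qed.
Lemma toric_is_multiplicative : monoid_morphism toric.
Proof. by split; [exact: rmorph1|exact: rmorphM]. Qed.
HB.instance Definition _ := GRing.isAdditive.Build S {poly K} toric toric_is_additive.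
HB.instance Definition _ := GRing.isMonoidMorphism.Build S {poly K} toric toric_is_multiplicative.

Lemma toricX i : toric 'X_i = toric_var i.
Proof. by rewrite /toric mmapX mmap1U. Qed.

Lemma toric_var_dvd i : exists q, toric_var i = q * 'X^40.
Proof.
rewrite /toric_var; case E : (toric_wt i) => [e|]; last by exists 0; rewrite mul0r.
exists 'X^(e - 40); rewrite -exprD subnK //; move: E; rewrite /toric_wt.
by do 7![case: ifP => _; first by move=> [<-]].
Qed.

Lemma toric_low p k : (k < 40)%N -> (toric p)`_k = if k == 0%N then p@_0%MM else 0.
Proof.
move=> k40.
have HX (m : 'X_{1..nvars n}) : (toric 'X_[m])`_k = ((m == 0%MM) && (k == 0%N))%:R.
  have [->|m0] := eqVneq m 0%MM; first by rewrite mpolyX0 rmorph1 coef1.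
  have [i mi] : exists i, m i != 0%N.
    by apply: contrapT => H; case/eqP: m0; apply/mnmP => i; rewrite mnm0E; apply/eqP; apply: contrapT => /negP ?; apply: H; exists i.
  rewrite -lep1mP in mi.
  rewrite -(submK mi) mpolyXD rmorphM /= toricX.
  by have [q ->] := toric_var_dvd i; rewrite mulrA coefMXn k40.
have H m : m \in msupp p -> (toric (p@_m *: 'X_[m]))`_k = p@_m * ((m == 0%MM) && (k == 0%N))%:R.
  by move=> _; rewrite -mul_mpolyC rmorphM /= {1}/toric mmapC mul_polyC coefZ HX.
rewrite {1}[p]mpolyE raddf_sum coef_sum big_seq (eq_bigr _ H) -big_seq.
case: eqP => k0; last by rewrite big1 // => m _; rewrite andbF mulr0.
have [p0|p0] := boolP (0%MM \in msupp p).
  rewrite (bigD1_seq 0%MM) //= eqxx mulr1 big1 ?addr0 // => m /negPf ->.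
  by rewrite mulr0.
rewrite (memN_msupp_eq0 p0) big_seq big1 // => m mp.
case: eqP => [E|]; rewrite ?mulr0 //.
by rewrite E (negPf p0) in mp.
Qed.

Lemma toric_var12 : toric_var n.+1 = 'X^44.
Proof.
rewrite /toric_var /toric_wt; do ?[case: ifP => [/eqP ?|_]; first by lia].
by rewrite eqxx.
Qed.

Lemma toric_var13 : toric_var n.+2 = 'X^50.
Proof.
rewrite /toric_var /toric_wt; do ?[case: ifP => [/eqP ?|_]; first by lia].
by rewrite eqxx.
Qed.

Lemma toric_var23 : toric_var n.*2 = 'X^52.
Proof.
rewrite /toric_var /toric_wt; do ?[case: ifP => [/eqP ?|_]; first by lia].
by rewrite eqxx.
Qed.

(** The exponents of 1, u_i and u_i^2: these are the images of the generators, up to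
    t^2 = X^80. *)
Definition toric_exps := [:: 0; 1; 3; 9; 2; 6; 18]%N.

Lemma toric_gen g : idealI_gens K n g ->
  toric g = 0 \/ exists2 e, e \in toric_exps & toric g = 'X^(80 + e).
Proof.
move=> /idealI_gensP[i [j [ij ->]]].
rewrite /deformed rmorphB rmorphM /= !toricX !yidxE.
have zE : (0 < i < j)%N ->
    toric ('X_(yidx ord0) * zvar K i j) = 'X^40 * toric_var (zpos n i j).
  move=> /andP[i0 ij']; rewrite rmorphM /= /zvar /xvar !toricX yidxE inordK //.
  by apply: zpos_lt => //; rewrite -ltnS.
have [j3|j3] := ltnP 3 j.
  left; have -> : toric_var j = 0.
    rewrite /toric_var /toric_wt; have := ltn_ord j.
    by do 7![case: ifP => [/eqP ?|_]; first by lia].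
  rewrite mulr0 sub0r; case: ifP => [h|_]; last by rewrite rmorph0 oppr0.
  rewrite zE //; case/andP: h => i0 ij'.
  have [h1 h2 h3 h4] := zpos_ge n2 i0 ij' j3 (ltn_ord j).
  rewrite /toric_var /toric_wt (negPf h2) (negPf h3) (negPf h4).
  by do 4![case: ifP => [/eqP ?|_]; first by lia]; rewrite mulr0 oppr0.
have i3 := leq_trans ij j3.
move: zE; case: i j ij j3 i3 => [i iN] [j jN] /= ij j3 i3 zE.
have E e : e \in toric_exps -> 'X^(80 + e) - 0 = 0 :> {poly K} \/
    exists2 e0, e0 \in toric_exps & 'X^(80 + e) - 0 = 'X^(80 + e0) :> {poly K}.
  by move=> eT; right; exists e; rewrite ?subr0.
have toric_vars : [/\ toric_var 0 = 'X^40, toric_var 1 = 'X^41,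
  toric_var 2 = 'X^43 & toric_var 3 = 'X^49] by [].
have [v0 v1 v2 v3] := toric_vars.
case: i iN ij i3 zE => [|[|[|[|//]]]] iN; case: j jN j3 => [|[|[|[|//]]]] jN //= _ _ _ zE;
  rewrite ?zE // ?zpos12 ?zpos13 ?zpos23 ?toric_var12 ?toric_var13 ?toric_var23 ?v0 ?v1 ?v2 ?v3 ?rmorph0 -?exprD.
- exact: (E 0%N).
- exact: (E 1%N).
- exact: (E 3%N).
- exact: (E 9%N).
- exact: (E 2%N).
- by left; rewrite subrr.
- by left; rewrite subrr.
- exact: (E 6%N).
- by left; rewrite subrr.
- exact: ltnW (ltnW n2).
- exact: (E 18%N).
Qed.

Lemma toricM p q : toric (p * q) = toric p * toric q.
Proof. exact: rmorphM. Qed.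

(** A multiplier without constant term raises the exponent to at least 200, so the
    coefficients below that are combinations of those of the products of two
    generators. *)
Lemma toric_square p N : ideal_exp (idealI K n) 2 p -> (N < 200)%N ->
    N \notin [seq 80 + a + (80 + b) | a <- toric_exps, b <- toric_exps]%N ->
  (toric p)`_N = 0.
Proof.
rewrite /idealI ideal_exp2 => -[m [c [g [Gg ->]]]] N200 NN.
rewrite raddf_sum coef_sum big1 // => i _.
have [g1 [g2 [G1 G2 ->]]] := Gg i; rewrite /= 2!toricM.
have [->|[a aT ->]] := toric_gen G1; first by rewrite mul0r mulr0 coef0.
have [->|[b bT ->]] := toric_gen G2; first by rewrite !mulr0 coef0.
rewrite -exprD coefMXn; case: ltnP => // le.
rewrite toric_low; last by lia.
case: eqP => // E; case/negP: NN; apply/allpairsP; exists (a, b); split=> //=.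
by lia.
Qed.

End Toric.

Section NotLinear.
Variables (K : fieldType) (n : nat).
Hypothesis charK : [pchar K] =i pred0.
Hypothesis n2 : (2 < n)%N.
Local Notation S := {mpoly K[nvars n]}.
Local Notation J := (ideal_exp (idealI K n) 2).

Let iy (k : nat) : 'I_n.+1 := inord k.

Lemma iyE k : (k <= 3)%N -> iy k = k :> nat.
Proof. by move=> k3; rewrite inordK // ltnS (leq_trans k3). Qed.

Let Y k : 'I_(nvars n) := yidx (iy k).
Let Z i j : 'I_(nvars n) := inord (zpos n i j).

(** It represents a nonzero element of S / J which z_12, z_13 and z_23 annihilate. *)
Let socle : S := 'X_(Y 0) * 'X_(Y 1) * 'X_(Y 2) * 'X_(Y 3).

Lemma square_mem g h : idealI_gens K n g -> idealI_gens K n h -> J (g * h).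
Proof. by move=> *; rewrite /idealI ideal_exp2; apply: ideal_gen_mem; exists g, h. Qed.

Lemma square_lin a f g : J f -> J g -> J (a * f + g).
Proof. rewrite /idealI ideal_exp2; exact: ideal_gen_lin. Qed.

(** Let Q = y_p y_q - x z_pq. Then x z_pq = y_p y_q - Q, and expanding twice expresses
    the product through y_p^2 y_q^2, Q^2 and x y_r Q. *)
Lemma mul_z_mem p q r : (0 < p)%N -> (p < q)%N -> (q <= 3)%N -> (r <= 3)%N ->
  J ('X_(Z p q) * ('X_(Y 0) * 'X_(Y p) * 'X_(Y q) * 'X_(Y r))).
Proof.
move=> p0 pq q3 r3.
have p3 : (p <= 3)%N by lia.
pose Q : S := 'X_(Y p) * 'X_(Y q) - 'X_(Y 0) * 'X_(Z p q).
have GQ : idealI_gens K n Q.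
  apply/idealI_gensP; exists (iy p), (iy q); rewrite !iyE //; split; first exact: ltnW.
  rewrite /deformed !iyE // p0 pq /zvar /xvar /Q; congr (_ - 'X_ _ * 'X_ _).
    by congr yidx; apply: val_inj; rewrite /= iyE.
  by rewrite /Z /zpos !iyE.
have G2 k : (k <= 3)%N -> idealI_gens K n ('X_(Y k) * 'X_(Y k)).
  move=> k3; apply/idealI_gensP; exists (iy k), (iy k); split=> //.
  by rewrite /deformed ltnn andbF subr0.
have Gx : idealI_gens K n ('X_(Y 0) * 'X_(Y r)).
  apply/idealI_gensP; exists ord0, (iy r); split=> //.
  rewrite /deformed subr0; congr ('X_ _ * _).
  by congr yidx; apply: val_inj; rewrite /= iyE.
have -> : 'X_(Z p q) * ('X_(Y 0) * 'X_(Y p) * 'X_(Y q) * 'X_(Y r)) =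
   'X_(Y r) * (('X_(Y p) * 'X_(Y p)) * ('X_(Y q) * 'X_(Y q)))
   + (- 'X_(Y r) * (Q * Q) + (- 'X_(Z p q) * ('X_(Y 0) * 'X_(Y r) * Q) + 0)).
  by rewrite /Q; ring.
have J0 : J 0 by rewrite /idealI ideal_exp2; apply: ideal_gen0.
apply: square_lin; first by apply: square_mem; apply: G2.
apply: square_lin; first exact: square_mem.
by apply: square_lin; first exact: square_mem.
Qed.

Lemma socle_mem : [/\ J ('X_(Z 1 2) * socle), J ('X_(Z 1 3) * socle) & J ('X_(Z 2 3) * socle)].
Proof.
split.
- exact: mul_z_mem.
- have -> : socle = 'X_(Y 0) * 'X_(Y 1) * 'X_(Y 3) * 'X_(Y 2) by rewrite /socle; ring.
  exact: mul_z_mem.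
- have -> : socle = 'X_(Y 0) * 'X_(Y 2) * 'X_(Y 3) * 'X_(Y 1) by rewrite /socle; ring.
  exact: mul_z_mem.
Qed.

Lemma YE k : (k <= 3)%N -> Y k = k :> nat.
Proof. by move=> k3; rewrite yidxE iyE. Qed.

Lemma ZE i j : (0 < i)%N -> (i < j)%N -> (j <= 3)%N -> Z i j = zpos n i j :> nat.
Proof. by move=> i0 ij j3; rewrite inordK // zpos_lt // (leq_trans j3). Qed.

Lemma toric_var_cases (h : 'I_(nvars n)) :
  [\/ toric_var K n h = 0, h = Y 0, h = Y 1 | h = Y 2] \/
  [\/ h = Y 3, h = Z 1 2, h = Z 1 3 | h = Z 2 3].
Proof.
have E (a : 'I_(nvars n)) k : nat_of_ord h == k -> nat_of_ord a = k -> h = a.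
  by move=> /eqP hk ak; apply: val_inj; rewrite /= hk ak.
rewrite {1}/toric_var /toric_wt.
case: ifP => [/E H|_]; first by left; apply: Or42; apply: H; rewrite YE.
case: ifP => [/E H|_]; first by left; apply: Or43; apply: H; rewrite YE.
case: ifP => [/E H|_]; first by left; apply: Or44; apply: H; rewrite YE.
case: ifP => [/E H|_]; first by right; apply: Or41; apply: H; rewrite YE.
case: ifP => [/E H|_]; first by right; apply: Or42; apply: H; rewrite ZE // zpos12.
case: ifP => [/E H|_]; first by right; apply: Or43; apply: H; rewrite ZE // zpos13.
case: ifP => [/E H|_]; last by left; apply: Or41.
by right; apply: Or44; apply: H; rewrite ZE // zpos23 // ltnW // ltnW.
Qed.

(** The relations R of [koszul_chase] are compared with the cycle in two components.
    In both, the only term that can be nonzero is alpha, by [toric_square]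
    and the alternation of R: 225 = 200 + 25 is the exponent of
    t^5 u_1 u_2^2 u_3^2, and 234 = 200 + 34 that of t^5 u_1 u_2^2 u_3^3. *)
Lemma square_nonlinear_syzygy (F : free_seq K (nvars n)) :
  minimal_graded_free_resolution F J ->
  exists j : 'I_(rk F 2), shift j = 7.
Proof.
move=> HF; apply: contrapT => nsh.
have hs : homog_deg 4 socle.
  by rewrite /socle -!mpolyXD /= dhomogX /= !mdegD !mdeg1.
have [J12 J13 J23] := socle_mem.
have [|R [JR Rc R0 RE]] := koszul_chase charK HF hs J12 J13 J23.
  by move=> j; apply/eqP => E; apply: nsh; exists j.
have Rl l m : R l m l = 0 by rewrite Rc R0.
have wY0 : toric_var K n (Y 0) = 'X^40 by rewrite YE.
have wY1 : toric_var K n (Y 1) = 'X^41 by rewrite YE.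
have wY2 : toric_var K n (Y 2) = 'X^43 by rewrite YE.
have wY3 : toric_var K n (Y 3) = 'X^49 by rewrite YE.
have n0 : (0 < n)%N by lia.
have vZ12 : Z 1 2 = n.+1 :> nat by rewrite ZE // zpos12.
have vZ13 : Z 1 3 = n.+2 :> nat by rewrite ZE // zpos13.
have vZ23 : Z 2 3 = n.*2 :> nat by rewrite ZE // zpos23.
have wZ12 : toric_var K n (Z 1 2) = 'X^44 by rewrite vZ12 toric_var12.
have wZ13 : toric_var K n (Z 1 3) = 'X^50 by rewrite vZ13 toric_var13.
have wZ23 : toric_var K n (Z 2 3) = 'X^52 by rewrite vZ23 toric_var23.
have ne (i j : 'I_(nvars n)) : nat_of_ord i != j -> (i == j) = false.
  by move=> /negPf; rewrite -val_eqE.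
have ab : (Z 1 2 == Z 1 3) = false by apply: ne; rewrite vZ12 vZ13; lia.
have ac : (Z 1 2 == Z 2 3) = false by apply: ne; rewrite vZ12 vZ23; lia.
have bc : (Z 1 3 == Z 2 3) = false by apply: ne; rewrite vZ13 vZ23; lia.
have ya : (Y 1 == Z 1 2) = false by apply: ne; rewrite vZ12 YE //; lia.
have yb : (Y 1 == Z 1 3) = false by apply: ne; rewrite vZ13 YE //; lia.
have yc : (Y 1 == Z 2 3) = false by apply: ne; rewrite vZ23 YE //; lia.
have coefE N l m : (toric (\sum_(h < nvars n) 'X_h * R l m h))`_N =
    \sum_(h < nvars n) (toric_var K n h * toric (R l m h))`_N.
  rewrite raddf_sum coef_sum; apply: eq_bigr => h _.
  by rewrite /= toricM toricX.
have Tz l m h N : (N < 200)%N ->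
    N \notin [seq 80 + a + (80 + b) | a <- toric_exps, b <- toric_exps]%N ->
    (toric (R l m h))`_N = 0 by move=> *; apply: toric_square => //; apply: JR.
(* 184 = 160 + 24 is the exponent of t^4 u_2^2 u_3^2. *)
pose alpha := (toric (R (Z 1 2) (Z 1 3) (Y 1)))`_184.
have S1 : (toric (\sum_(h < nvars n) 'X_h * R (Z 1 2) (Z 1 3) h))`_225 = alpha.
  rewrite coefE (bigD1 (Y 1)) //= big1 => [|h hY].
    by rewrite wY1 coefXnM addr0.
  case: (toric_var_cases h) => [[H|H|H|H]|[H|H|H|H]].
  - by rewrite H mul0r coef0.
  - by rewrite H wY0 coefXnM Tz.
  - by rewrite H eqxx in hY.
  - by rewrite H wY2 coefXnM Tz.
  - by rewrite H wY3 coefXnM Tz.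
  - by rewrite H Rl rmorph0 mulr0 coef0.
  - by rewrite H R0 rmorph0 mulr0 coef0.
  - by rewrite H wZ23 coefXnM Tz.
have S2 : (toric (\sum_(h < nvars n) 'X_h * R (Y 1) (Z 1 2) h))`_234 = alpha.
  rewrite coefE (bigD1 (Z 1 3)) //= big1 => [|h hb].
    by rewrite wZ13 coefXnM addr0 Rc.
  case: (toric_var_cases h) => [[H|H|H|H]|[H|H|H|H]].
  - by rewrite H mul0r coef0.
  - by rewrite H wY0 coefXnM Tz.
  - by rewrite H Rl rmorph0 mulr0 coef0.
  - by rewrite H wY2 coefXnM Tz.
  - by rewrite H wY3 coefXnM Tz.
  - by rewrite H R0 rmorph0 mulr0 coef0.
  - by rewrite H eqxx in hb.
  - by rewrite H wZ23 coefXnM Tz.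
have ba : (Z 1 3 == Z 1 2) = false by rewrite eq_sym.
have cb : (Z 2 3 == Z 1 3) = false by rewrite eq_sym.
have A1 : alpha = 1.
  rewrite -S1 -RE /alt2 !eqxx ab ac bc ba /= !(subr0, mul0r, addr0) mul1r.
  rewrite /socle !toricM !toricX wY0 wY1 wY2 wY3 wZ23 -!exprD.
  exact: coefXn.
have A0 : alpha = 0.
  rewrite -S2 -RE /alt2 ya yb yc /= subr0 !(mul0r, addr0).
  by rewrite rmorph0 coef0.
by move: A1; rewrite A0 => /eqP; rewrite eq_sym oner_eq0.
Qed.

Lemma reg_square_gt4 : (4%:E < reg J)%E.
Proof.
pose G : set S := [set f | exists g h, [/\ idealI_gens K n g, idealI_gens K n h & f = g * h]]%classic.
have HG g : G g -> g \is 4.-homog.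
  by move=> [g1 [g2 [/idealI_gens_homog h1 /idealI_gens_homog h2 ->]]]; apply: (dhomogM h1 h2).
have [F] := homog_ideal_resolution HG; rewrite -ideal_exp2 -/(idealI K n) => HF.
have [j Ej] := square_nonlinear_syzygy HF.
apply: (@lt_le_trans _ _ (shift j - 2%:Z)%:E); first by rewrite Ej.
by apply: supremum_ge; exists F, 2%N, j.
Qed.

End NotLinear.

Lemma two_lt_sub2 (r : \bar int) : (4%:E < r)%E -> (2%:Z%:E < r - 2%:E)%E.
Proof.
by case: r => [r||] //=; rewrite ?ltry // -EFinB !lte_fin ltrBrDr.
Qed.

Local Open Scope classical_set_scope.
Local Open Scope ring_scope.

Theorem theorem3p4 (K : fieldType) (charK : [pchar K] =i pred0) :
  (forall n : nat, (3 <= n)%N ->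
     reg (idealI K n) = 2%:E /\ (4%:E < reg (ideal_exp (idealI K n) 2))%E) /\
  (~ cardinality.finite_set
       [set existT (fun s => set {mpoly K[s]}) (nvars n) (idealI K n)
          | n in [set n : nat | (3 <= n)%N]] /\
   forall n : nat, (3 <= n)%N -> regularity_jump (idealI K n) 2).
Proof.
split; first by move=> n n3; split; [exact: reg_idealI|exact: reg_square_gt4].
split; first exact: (@infinite_family (fun s => set {mpoly K[s]}) (idealI K)).
move=> n n3; split=> //; exists 2; split.
  by exists (idealI_gens K n); split=> // g; apply: idealI_gens_homog.
rewrite [in X in (_ < _ - X)%E]/idealI ideal_exp1 -/(idealI K n) reg_idealI.
by apply: two_lt_sub2; apply: reg_square_gt4.
Qed.
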